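(* Let $A\in\mathbb{C}^{n\times N}$, let $S\subset\{1,\dots,N\}$ with $|S|=k$ such that $A_S$ has full column rank, and suppose that for some $\alpha<1$ $$\|A_S^\dagger a_\ell\|_2\le\alpha\quad\text{for all }\ell\notin S.$$ Let $X\in\mathbb{C}^{N\times L}$ have all rows outside $S$ equal to zero and $X^S=\Sigma\Phi$, where $\Sigma\in\mathbb{R}^{k\times k}$ is a (deterministic) diagonal matrix with positive diagonal entries and $\Phi\in\mathbb{R}^{k\times L}$ is drawn from the real Gaussian model or the real spherical model. Then with probability at least $$1-N\exp\Big(-\frac{L}{2}\big(\alpha^{-2}-\log(\alpha^{-2})-1\big)\Big)$$ $X$ is the unique solution of $\min_Z\|Z\|_{2,1}$ subject to $AZ=AX$. If instead $\Phi\in\mathbb{C}^{k\times L}$ is drawn from the complex Gaussian or complex spherical model, the same holds with $L/2$ replaced by $L$ in the probability bound.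
   Context: $a_\ell$ is the $\ell$-th column of $A$, $A_S$ the submatrix of columns indexed by $S$, $A_S^\dagger=(A_S^*A_S)^{-1}A_S^*$. For $X\in\mathbb{C}^{N\times L}$, $X^j$ is its $j$-th row, $X^S$ the rows indexed by $S$, and $\|X\|_{2,1}=\sum_j\|X^j\|_2$. Probability models for $\Phi$: real Gaussian — all entries independent standard normal; real spherical — rows independent, each uniform on the unit sphere of $\mathbb{R}^L$; complex Gaussian — real and imaginary parts of all entries independent standard normal; complex spherical — rows independent, each uniform on the unit sphere of $\mathbb{C}^L$. *)

(* Defs.v *)
From HB Require Import structures.
From mathcomp Require Import all_boot all_order all_algebra.
From mathcomp Require Import all_classical all_reals all_analysis.
From mathcomp Require Import complex.

Set Implicit Arguments.
Unset Strict Implicit.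
Unset Printing Implicit Defensive.

Import Order.TTheory GRing.Theory Num.Theory.
Local Open Scope ring_scope.
Local Open Scope classical_set_scope.

Section Defs.
Variable R : realType.
Local Notation C := (R[i]).

Definition cmod (z : C) : R := Num.sqrt (complex.Re z ^+ 2 + complex.Im z ^+ 2).

Definition cconj (z : C) : C := Complex (complex.Re z) (- complex.Im z).
Definition adjmx m n (M : 'M[C]_(m, n)) : 'M[C]_(n, m) :=
  \matrix_(i, j) cconj (M j i).

Definition vnorm2 m (v : 'cV[C]_m) : R := Num.sqrt (\sum_i cmod (v i ord0) ^+ 2).

Definition norm21 N L (X : 'M[C]_(N, L)) : R :=
  \sum_(j < N) Num.sqrt (\sum_(c < L) cmod (X j c) ^+ 2).

Definition colS n N (A : 'M[C]_(n, N)) (S : {set 'I_N}) : 'M[C]_(n, #|S|) :=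
  \matrix_(r, c) A r (enum_val c).

Definition pinvS n N (A : 'M[C]_(n, N)) (S : {set 'I_N}) : 'M[C]_(#|S|, n) :=
  invmx (adjmx (colS A S) *m colS A S) *m adjmx (colS A S).

Definition unique_l21_min n N L (A : 'M[C]_(n, N)) (X : 'M[C]_(N, L)) : Prop :=
  forall Z : 'M[C]_(N, L), A *m Z = A *m X -> Z <> X -> norm21 X < norm21 Z.

Context {d : measure_display} {T : measurableType d} (P : probability T R).

(* a finite family of random variables with values in a measurable type is
   (mutually) independent: each is measurable, and the product rule holds for
   every family of measurable sets (taking B i = setT recovers subfamilies) *)
Definition mutually_independent {d' : measure_display} {V : measurableType d'}
    (I : finType) (Y : I -> T -> V) : Prop :=
  (forall i, measurable_fun setT (Y i)) /\
  forall B : I -> set V, (forall i, measurable (B i)) ->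
    P (\bigcap_(i in [set: I]) (Y i @^-1` B i)) = (\prod_(i : I) P (Y i @^-1` B i))%E.

Definition std_normal (Y : T -> R) : Prop :=
  forall B : set R, measurable B -> P (Y @^-1` B) = normal_prob 0 1 B.

(* rows of matrices, as tuples (which carry the product sigma-algebra) *)
Definition rrow k L (M : 'M[R]_(k, L)) (i : 'I_k) : L.-tuple R :=
  [tuple M i j | j < L].
Definition crow k L (M : 'M[C]_(k, L)) (i : 'I_k) : L.-tuple (R * R) :=
  [tuple (complex.Re (M i j), complex.Im (M i j)) | j < L].

(* the uniform distribution on the unit sphere of R^L is the (unique)
   rotation-invariant probability measure on the sphere: a random row vector
   Y has it iff |Y| = 1 almost surely and Y Q has the same law as Y for every
   orthogonal Q *)
Definition uniform_sphere_R L (Y : T -> 'rV[R]_L) : Prop :=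
  P [set t | \sum_j Y t ord0 j ^+ 2 = 1] = 1%E /\
  forall Q : 'M[R]_L, Q *m Q^T = 1%:M ->
    forall B : set (L.-tuple R), measurable B ->
      P ((fun t => rrow (Y t) ord0) @^-1` B) =
      P ((fun t => rrow (Y t *m Q) ord0) @^-1` B).

Definition uniform_sphere_C L (Y : T -> 'rV[C]_L) : Prop :=
  P [set t | \sum_j cmod (Y t ord0 j) ^+ 2 = 1] = 1%E /\
  forall U : 'M[C]_L, U *m adjmx U = 1%:M ->
    forall B : set (L.-tuple (R * R)), measurable B ->
      P ((fun t => crow (Y t) ord0) @^-1` B) =
      P ((fun t => crow (Y t *m U) ord0) @^-1` B).

Definition real_gaussian k L (Phi : T -> 'M[R]_(k, L)) : Prop :=
  mutually_independent (fun ij : 'I_k * 'I_L => fun t => Phi t ij.1 ij.2) /\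
  forall i j, std_normal (fun t => Phi t i j).

Definition real_spherical k L (Phi : T -> 'M[R]_(k, L)) : Prop :=
  mutually_independent (fun i : 'I_k => fun t => rrow (Phi t) i) /\
  forall i, uniform_sphere_R (fun t => row i (Phi t)).

Definition complex_gaussian k L (Phi : T -> 'M[C]_(k, L)) : Prop :=
  let part (x : 'I_k * 'I_L * bool) t :=
    if x.2 then complex.Re (Phi t x.1.1 x.1.2) else complex.Im (Phi t x.1.1 x.1.2) in
  mutually_independent part /\ forall x, std_normal (part x).

Definition complex_spherical k L (Phi : T -> 'M[C]_(k, L)) : Prop :=
  mutually_independent (fun i : 'I_k => fun t => crow (Phi t) i) /\
  forall i, uniform_sphere_C (fun t => row i (Phi t)).

(* "E holds with probability at least p": some measurable event contained in E
   has probability >= p (inner probability; equals P E when E is measurable) *)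
Definition prob_at_least (E : set T) (p : R) : Prop :=
  exists F : set T, measurable F /\ F `<=` E /\ (p%:E <= P F)%E.

End Defs.

(* Main.v *)
Require Import Defs.
From HB Require Import structures.
From mathcomp Require Import all_boot all_order all_algebra.
From mathcomp Require Import all_classical all_reals all_analysis.
From mathcomp Require Import complex measurable_realfun ring lra.
Import Order.TTheory GRing.Theory Num.Theory.
Local Open Scope ring_scope.
Local Open Scope classical_set_scope.

(** If s_i is the i-th row of X^S divided by its norm and v = A_S^+ a_l, then X is
    the unique minimiser as soon as |sum_i conj(v_i) s_i| < 1 for every l outside
    S, so a union bound reduces the theorem to a tail estimate for this sum.

    In all four models the law of <u, s_i> depends only on |u|, where s_i is seen
    in R^M with M = L or M = 2 L: for spherical rows by a Householder map, for
    Gaussian rows because a plane rotation of an iid standard normal family is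
    again one.  Comparing the coefficients of y^2 in
    E (s_1 + y s_2)^(2p) = (1 + y^2)^p E s_1^(2p) bounds the moments of s_1
    recursively, which gives E exp <w, s> <= exp (|w|^2 / (2 M)).

    For independent U_i with |U_i|^2 <= rho_i and
    E exp <x, U_i> <= exp (rho_i |x|^2 / (2 M)), one replaces the summands one at
    a time to get E exp (theta |sum U_i|^2) <= (1 - 2 theta (sum rho_i) / M)^(-M/2),
    the value attained by Gaussian vectors of R^M; Markov's inequality with
    theta = (alpha^-2 - 1) M / 2 finishes the proof. *)

(** * Independence *)

(** The coefficients v_i are complex even when the rows s_i are real. In the real models the
    summands conj(v_i) s_i therefore live in R^(2 L), while the rate has to be that of R^L.
    Linearising exp (theta |Z|^2) with a Gaussian vector and then using the bound on E exp <x, U_i>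
    would produce the exponent of dimension 2 L. Replacing one summand at a time charges the squared
    length rho_i = |v_i|^2 instead of the ambient dimension, so the proof keeps the dimension [n] of
    the summands apart from the variance parameter [M]. The uniform law on the sphere is given by
    rotation invariance, with no density. This is why only the laws of the functionals <u, s_i> are
    compared, and why the moments come from an algebraic identity rather than from an integral. The
    matrix [Sigma] disappears because a positive factor does not change the direction of a row. A
    zero row is normalised to zero, so that |s_i| <= 1 holds at every sample point and no almost
    sure exception has to be carried along. *)

Lemma preimage_measurable {d d' : measure_display} {T : measurableType d}
    {V : measurableType d'} (W : T -> V) (A : set V) :
  measurable_fun setT W -> measurable A -> measurable (W @^-1` A).
Proof. by move=> mW mA; rewrite -[X in measurable X]setTI; exact: mW. Qed.

Section Independence.
Context {R : realType} {d : measure_display} {T : measurableType d}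
  (P : probability T R).
Local Open Scope ereal_scope.

(** Both sides are finite measures in [A] that agree on a pi-system containing the whole space.
    Holding [E] fixed lets one variable be freed at a time. *)
Lemma indep_event_ext {d' : measure_display} {V : measurableType d'}
    (W : T -> V) (E : set T) (G : set (set V)) :
  measurable_fun setT W -> measurable E ->
  (measurable : set (set V)) = <<s G >> -> setI_closed G -> G setT ->
  (forall A, G A -> P (W @^-1` A `&` E) = P (W @^-1` A) * P E) ->
  forall A, measurable A -> P (W @^-1` A `&` E) = P (W @^-1` A) * P E.
Proof.
move=> mW mE mG GI GT PG A mA.
have PE0 : (0 <= fine (P E))%R by rewrite fine_ge0.
pose m1 : {measure set V -> \bar R} := pushforward (mrestr P mE) W.
pose m2 : {measure set V -> \bar R} := mscale (NngNum PE0) (pushforward P W).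
have PEf : P E = (fine (P E))%:E by rewrite fineK// fin_num_measure.
have : m1 mW A = m2 mW A.
  apply: (measure_unique G (fun=> setT)) => //.
  - by rewrite bigcup_const.
  - move=> B GB; rewrite /m1 /m2 /= /mscale /= /pushforward /mrestr PG// muleC.
    by rewrite -PEf.
  - move=> k; rewrite /m1 /= /pushforward /mrestr preimage_setT setTI.
    by rewrite (le_lt_trans (probability_le1 P mE))// ltry.
rewrite /m1 /m2 /= /mscale /= /pushforward /mrestr => ->.
by rewrite -PEf muleC.
Qed.

Lemma bigcap_finD1 {I : finType} (i0 : I) (F : I -> set T) :
  \bigcap_(i in [set: I]) F i =
  F i0 `&` \bigcap_(i in [set: I]) (if i == i0 then setT else F i).
Proof.
apply/seteqP; split => t /=.
  by move=> Ft; split; [exact: Ft|move=> i _; case: ifP => // _; exact: Ft].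
move=> [F0 Ft] i _; have [->//|ne] := eqVneq i i0.
by move: (Ft i Logic.I); rewrite (negbTE ne).
Qed.

Lemma bigcap_fin_measurable {I : finType} (F : I -> set T) :
  (forall i, measurable (F i)) -> measurable (\bigcap_(i in [set: I]) F i).
Proof. by move=> mF; apply: fin_bigcap_measurable => //; exact: finite_finset. Qed.

(** The sets are enlarged from [G] to all measurable sets one index at a time, the constraints at
    the other indices forming one fixed event. *)
Lemma mutually_independent_pi {d' : measure_display} {V : measurableType d'}
    (I : finType) (Y : I -> T -> V) (G : set (set V)) :
  (forall i, measurable_fun setT (Y i)) ->
  (measurable : set (set V)) = <<s G >> -> setI_closed G -> G setT ->
  (forall B : I -> set V, (forall i, G (B i)) ->
    P (\bigcap_(i in [set: I]) (Y i @^-1` B i)) = \prod_(i : I) P (Y i @^-1` B i)) ->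
  mutually_independent P Y.
Proof.
move=> mY mG GI GT PG; split => // B0 mB0.
have Gm A : G A -> measurable A by rewrite mG; exact: sub_sigma_algebra.
(* [s] lists the indices at which the set is already arbitrary. *)
suff H : forall (s : seq I) (B : I -> set V), (forall i, measurable (B i)) ->
    (forall i, i \notin s -> G (B i)) ->
    P (\bigcap_(i in [set: I]) (Y i @^-1` B i)) = \prod_(i : I) P (Y i @^-1` B i).
  by apply: (H (enum I)) => // i /negP[]; rewrite mem_enum.
elim => [|i0 s IH] B mB GB; first by apply: PG => i; exact: GB.
pose E := \bigcap_(i in [set: I]) (if i == i0 then setT else Y i @^-1` B i).
pose U A i := if i == i0 then A else B i.
have UE A : \bigcap_(i in [set: I]) (Y i @^-1` U A i) = Y i0 @^-1` A `&` E.
  rewrite (bigcap_finD1 i0) /U eqxx; congr (_ `&` _).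
  by apply: eq_bigcapr => i _; case: eqP.
have rule A : measurable A -> G A \/ i0 \in s ->
    P (Y i0 @^-1` A `&` E) = P (Y i0 @^-1` A) * \prod_(i | i != i0) P (Y i @^-1` B i).
  move=> mA GA; rewrite -UE IH.
  - rewrite (bigD1 i0)//= /U eqxx; congr (_ * _).
    by apply: eq_bigr => i /negbTE ->.
  - by move=> i; rewrite /U; case: ifP.
  - move=> i is_; rewrite /U; case: ifP => [/eqP ii0|ne].
      by case: GA => //; rewrite -ii0 (negbTE is_).
    by apply: GB; rewrite in_cons ne.
have -> : \bigcap_(i in [set: I]) (Y i @^-1` B i) = Y i0 @^-1` B i0 `&` E.
  exact: bigcap_finD1.
have mE : measurable E.
  by apply: bigcap_fin_measurable => i; case: ifP => // _; exact: preimage_measurable.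
have PE : P E = \prod_(i | i != i0) P (Y i @^-1` B i).
  have := rule setT measurableT (or_introl GT).
  by rewrite preimage_setT setTI probability_setT mul1e.
rewrite (indep_event_ext (Y i0) E G) => //.
  by rewrite PE [in RHS](bigD1 i0)//=.
by move=> A GA; rewrite PE; apply: rule; [exact: Gm|left].
Qed.

Lemma mutually_independent_comp {d1 d2 : measure_display} {V1 : measurableType d1}
    {V2 : measurableType d2} (I : finType) (Y : I -> T -> V1) (phi : I -> V1 -> V2) :
  (forall i, measurable_fun setT (phi i)) ->
  mutually_independent P Y -> mutually_independent P (fun i => phi i \o Y i).
Proof.
move=> mphi [mY PY]; split=> [i|B mB]; first exact: measurableT_comp.
by apply: (PY (fun i => phi i @^-1` B i)) => i; exact: preimage_measurable.
Qed.

(** Indices outside the image of [f] receive the whole space, which contributes the factor 1. *)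
Lemma mutually_independent_inj {d' : measure_display} {V : measurableType d'}
    (I J : finType) (Y : I -> T -> V) (f : J -> I) : injective f ->
  mutually_independent P Y -> mutually_independent P (Y \o f).
Proof.
move=> injf [mY PY]; split=> [j|B mB]; first exact: mY.
pose B' i := if [pick j | f j == i] is Some j then B j else setT.
have B'f j : B' (f j) = B j.
  rewrite /B'; case: pickP => [j' /eqP/injf ->//|/(_ j)]; by rewrite eqxx.
have mB' i : measurable (B' i) by rewrite /B'; case: pickP.
have := PY B' mB'.
have -> : \bigcap_(i in [set: I]) (Y i @^-1` B' i) =
    \bigcap_(j in [set: J]) ((Y \o f) j @^-1` B j).
  apply/seteqP; split=> t /= H i _.
    by have := H (f i) Logic.I; rewrite B'f.
  by rewrite /B'; case: pickP => // j /eqP <-; exact: H.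
move=> ->; rewrite (bigID (fun i => i \in codom f))/= [X in _ * X]big1 ?mule1.
  rewrite -big_uniq/=; last by rewrite map_inj_uniq ?enum_uniq.
  by rewrite big_image; apply: eq_bigr => j _; rewrite B'f.
move=> i fi; rewrite /B'; case: pickP => [j /eqP ij|_].
  by move: fi; rewrite -ij codom_f.
by rewrite preimage_setT probability_setT.
Qed.

End Independence.

(** * Boxes as generators of the product sigma-algebra on tuples *)

Section Tuples.
Context {d : measure_display} {V : measurableType d}.

Definition rect n (B : 'I_n -> set V) : set (n.-tuple V) :=
  [set y | forall i, B i (tnth y i)].

(** Boxes are stable under intersection, unlike the one-coordinate cylinders that define the
    sigma-algebra. *)
Definition rects n : set (set (n.-tuple V)) :=
  [set C | exists2 B : 'I_n -> set V, (forall i, measurable (B i)) & C = rect n B].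

Lemma measurable_rects n : (measurable : set (set (n.-tuple V))) = <<s rects n >>.
Proof.
apply/seteqP; split.
- apply: smallest_sub; first exact: smallest_sigma_algebra.
  case: n => [|n]; first by rewrite big_ord0.
  rewrite -bigcup_mkord_ord; apply: bigcup_sub => i Ii A [B mB <-].
  apply: sub_sigma_algebra.
  exists (fun j => if j == inord i then B else setT); first by move=> j; case: ifP.
  rewrite setTI; apply/seteqP; split => y /=.
    by move=> yB j; case: ifP => // /eqP ->.
  by move=> /(_ (inord i)); rewrite eqxx.
- apply: smallest_sub; first exact: sigma_algebra_measurable.
  move=> C [B mB ->].
  have -> : rect n B = \bigcap_(i in [set: 'I_n]) ((@tnth _ V ^~ i) @^-1` B i).
    by apply/seteqP; split => y /= H i; [move=> _|]; exact: H.
  apply: fin_bigcap_measurable => [|i _]; first exact: finite_finset.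
  by rewrite -[X in measurable X]setTI; exact: measurable_tnth.
Qed.

Lemma setI_closed_rects n : setI_closed (rects n).
Proof.
move=> _ _ [B mB ->] [B' mB' ->].
exists (fun i => B i `&` B' i); first by move=> i; exact: measurableI.
apply/seteqP; split => y /=; first by move=> [H H'] i; split.
by move=> H; split => i; have [] := H i.
Qed.

Lemma rectsT n : rects n setT.
Proof. by exists (fun=> setT) => //; apply/seteqP; split. Qed.

End Tuples.

(** Passes from independent entries to independent rows. On boxes the probability is a product over
    all pairs, which regroups row by row. *)
Lemma mutually_independent_tuple {R : realType} {d d' : measure_display}
    {T : measurableType d} {V : measurableType d'} (P : probability T R)
    (I : finType) n (Y : I * 'I_n -> T -> V) :
  mutually_independent P Y ->
  mutually_independent P (fun i t => [tuple Y (i, j) t | j < n]).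
Proof.
move=> [mY PY].
have rectE i B : (fun t => [tuple Y (i, j) t | j < n]) @^-1` rect n B =
    \bigcap_(j in [set: 'I_n]) (Y (i, j) @^-1` B j).
  apply/seteqP; split=> t /= H j; first by have := H j; rewrite tnth_mktuple.
  by rewrite tnth_mktuple; exact: H.
apply: (mutually_independent_pi P _ _ (rects n)).
- move=> i; apply/measurable_fun_tnthP => j.
  by apply: eq_measurable_fun (mY (i, j)) => t _ /=; rewrite tnth_mktuple.
- exact: measurable_rects.
- exact: setI_closed_rects.
- exact: rectsT.
- move=> C /(_ _)/cid2-/all_sig2[B mB CB].
  have -> : \bigcap_(i in [set: I])
      ((fun t => [tuple Y (i, j) t | j < n]) @^-1` C i) =
      \bigcap_(x in [set: I * 'I_n]) (Y x @^-1` B x.1 x.2).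
    under eq_bigcapr do rewrite CB rectE.
    by apply/seteqP; split=> t /= H => [[i j] _|i _ j _]; [exact: H|exact: (H (i, j))].
  rewrite (PY (fun x => B x.1 x.2)); last by move=> x; exact: mB.
  rewrite (eq_bigr (fun x => P (Y (x.1, x.2) @^-1` B x.1 x.2))); last by case.
  rewrite -(pair_bigA _ (fun i j => P (Y (i, j) @^-1` B i j)))/=.
  apply: eq_bigr => i _; rewrite CB rectE.
  have inji : injective (fun j : 'I_n => (i, j)) by move=> j j' [].
  have [_ ind] := mutually_independent_inj P _ _ Y _ inji (conj mY PY).
  by rewrite -ind.
Qed.

(** * Partial sums of independent vectors *)

Definition tsq {R : realType} {n} (x : n.-tuple R) : R := \sum_(c < n) tnth x c ^+ 2.

Lemma measurable_tnth_real {R : realType} n (c : 'I_n) :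
  measurable_fun setT (fun x : n.-tuple R => tnth x c).
Proof. exact: measurable_tnth. Qed.

Lemma measurable_tsq {R : realType} n : measurable_fun setT (@tsq R n).
Proof.
apply: measurable_sum => c; apply: measurable_funX; exact: measurable_tnth_real.
Qed.

Definition tadd {R : realType} {n} (x y : n.-tuple R) : n.-tuple R :=
  [tuple tnth x c + tnth y c | c < n].

Lemma measurable_tadd {R : realType} n :
  measurable_fun setT (fun z : n.-tuple R * n.-tuple R => tadd z.1 z.2).
Proof.
apply/measurable_fun_tnthP => c.
apply: (eq_measurable_fun (fun z : n.-tuple R * n.-tuple R => tnth z.1 c + tnth z.2 c)).
  by move=> z _ /=; rewrite tnth_mktuple.
by apply: measurable_funD;
  [apply: (measurableT_comp (measurable_tnth_real n c) measurable_fst)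
  |apply: (measurableT_comp (measurable_tnth_real n c) measurable_snd)].
Qed.

Section PartialSums.
Context {R : realType} {d : measure_display} {T : measurableType d}
  (P : probability T R).
Local Open Scope ereal_scope.

Definition indep_pair {d1 d2 : measure_display} {E : measurableType d1}
    {V : measurableType d2} (Z : T -> E) (U : T -> V) :=
  forall A B, measurable A -> measurable B ->
    P (Z @^-1` A `&` U @^-1` B) = P (Z @^-1` A) * P (U @^-1` B).

(** Independence makes the joint law a product measure. After Tonelli each factor is pulled back to
    [T], so [s] is a second, independent sample point. *)
Lemma ge0_integral_indep {d1 d2 : measure_display} {E : measurableType d1}
    {V : measurableType d2} (Z : T -> E) (U : T -> V) (f : E * V -> \bar R) :
  measurable_fun setT Z -> measurable_fun setT U -> indep_pair Z U ->
  measurable_fun setT f -> (forall x, 0 <= f x) ->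
  \int[P]_t f (Z t, U t) = \int[P]_t \int[P]_s f (Z t, U s).
Proof.
move=> mZ mU ind mf f0.
have mZU : measurable_fun setT (fun t => (Z t, U t)) by exact: measurable_fun_pair.
pose X1 : {mfun T >-> E} := HB.pack Z (isMeasurableFun.Build _ _ _ _ Z mZ).
pose X2 : {mfun T >-> V} := HB.pack U (isMeasurableFun.Build _ _ _ _ U mU).
pose X : {mfun T >-> (E * V)%type} :=
  HB.pack (fun t => (Z t, U t)) (isMeasurableFun.Build _ _ _ _ _ mZU).
transitivity (\int[distribution P X]_z f z).
  by rewrite (ge0_integral_distribution _ mf f0).
transitivity (\int[distribution P X1 \x distribution P X2]_z f z).
  apply: eq_measure_integral => C mC _; apply/esym.
  exact: product_measure_unique.
rewrite fubini_tonelli1// (ge0_integral_distribution X1); last first.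
- by move=> x; exact: integral_ge0.
- exact: measurable_fun_fubini_tonelli_F.
apply: eq_integral => t _ /=; rewrite /fubini_F.
by rewrite (ge0_integral_distribution X2 (measurable_fun_pair2 _ mf)).
Qed.

Variables (n k : nat) (U : 'I_k -> T -> n.-tuple R).
Hypothesis indU : mutually_independent P U.

(** Testing [i < m] under a sum over all of ['I_k] lets [m] be any natural number, so inductions on
    [m] need no change of index type. *)
Definition psum (m : nat) (t : T) : n.-tuple R :=
  [tuple (\sum_(i < k) if (i < m)%N then tnth (U i t) c else 0)%R | c < n].

Let mU i : measurable_fun setT (U i). Proof. by case: indU => + _; apply. Qed.

Let mUc i c : measurable_fun setT (fun t => tnth (U i t) c).
Proof. by apply: (measurableT_comp (measurable_tnth_real _ c)). Qed.

Lemma measurable_psum m : measurable_fun setT (psum m).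
Proof.
apply/measurable_fun_tnthP => c.
apply: (eq_measurable_fun
    (fun t => \sum_(i < k) if (i < m)%N then tnth (U i t) c else 0)%R).
  by move=> t _ /=; rewrite tnth_mktuple.
by apply: measurable_sum => i /=; case: (i < m)%N.
Qed.

Lemma psum0 t : psum 0 t = [tuple 0%R | c < n].
Proof. by apply: eq_from_tnth => c; rewrite !tnth_mktuple big1. Qed.

Lemma psumS (i : 'I_k) t : psum i.+1 t = tadd (psum i t) (U i t).
Proof.
apply: eq_from_tnth => c; rewrite !tnth_mktuple (bigD1 i)//= ltnSn.
rewrite [in RHS](bigD1 i)//= ltnn add0r addrC; congr (_ + _)%R.
apply: eq_bigr => j ji; rewrite ltnS leq_eqVlt.
by rewrite -[(j == i :> nat)]/(j == i) (negbTE ji).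
Qed.

(** An event about the summands not yet added to [psum m]. *)
Let ev (B : 'I_k -> set (n.-tuple R)) m :=
  \bigcap_(i in [set: 'I_k]) (U i @^-1` (if (m <= i)%N then B i else setT)).

Let mev B m : (forall i, measurable (B i)) -> measurable (ev B m).
Proof.
move=> mB; apply: bigcap_fin_measurable => i; apply: preimage_measurable => //.
by case: ifP.
Qed.

Let Pev B m : (forall i, measurable (B i)) ->
  P (ev B m) = \prod_(i < k) if (m <= i)%N then P (U i @^-1` B i) else 1.
Proof.
move=> mB; rewrite (proj2 indU); last by move=> i; case: ifP.
by apply: eq_bigr => i _; case: ifP => // _; rewrite preimage_setT probability_setT.
Qed.

Let evS B (i : 'I_k) : ev B i = U i @^-1` B i `&` ev B i.+1.
Proof.
rewrite /ev (bigcap_finD1 i) leqnn; congr (_ `&` _).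
apply: eq_bigcapr => j _; have [->|ji] := eqVneq j i; first by rewrite ltnn.
by rewrite ltn_neqAle -[(nat_of_ord i == j)]/(i == j) eq_sym ji.
Qed.

Let PevS B (i : 'I_k) : (forall i, measurable (B i)) ->
  P (ev B i) = P (U i @^-1` B i) * P (ev B i.+1).
Proof.
move=> mB; rewrite !Pev// (bigD1 i)//= leqnn; congr (_ * _).
rewrite [in RHS](bigD1 i)//= ltnn mul1e; apply: eq_bigr => j ji.
by rewrite ltn_neqAle -[(nat_of_ord i == j)]/(i == j) eq_sym ji.
Qed.

(** [psum m.+1] is a function of [psum m] and [U m], so rectangles in these two suffice. The
    induction quantifies over all [B] because the side for [U m] is absorbed into the future
    event. *)
Lemma psum_indep_ev m B A : (m <= k)%N -> (forall i, measurable (B i)) ->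
  measurable A -> P (psum m @^-1` A `&` ev B m) = P (psum m @^-1` A) * P (ev B m).
Proof.
elim: m B A => [|m IH] B A mk mB mA.
  (* The empty sum is constant: its event is everything or nothing. *)
  have [A0|A0] := pselect (A [tuple 0%R | c < n]).
    have -> : psum 0 @^-1` A = setT.
      by apply/seteqP; split => // t _ /=; rewrite psum0.
    by rewrite setTI probability_setT mul1e.
  have -> : psum 0 @^-1` A = set0.
    by apply/seteqP; split => // t /=; rewrite psum0.
  by rewrite set0I measure0 mul0e.
pose i := Ordinal mk.
pose W t := (psum m t, U i t).
have mW : measurable_fun setT W.
  by apply: measurable_fun_pair => //; exact: measurable_psum.
have WA C : psum m.+1 @^-1` C = W @^-1` ((fun z => tadd z.1 z.2) @^-1` C).
  by apply/seteqP; split => t /=; rewrite (psumS i).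
rewrite WA; pose G : set (set (n.-tuple R * n.-tuple R)) :=
  [set A `*` B | A in measurable & B in measurable].
apply: (indep_event_ext P W _ G) => //.
- exact: mev.
- exact: measurable_prod_measurableType.
- move=> _ _ [X1 mX1 [X2 mX2 <-]] [Y1 mY1 [Y2 mY2 <-]]; rewrite -setXI.
  by exists (X1 `&` Y1); [exact: measurableI|exists (X2 `&` Y2) => //; exact: measurableI].
- by exists setT => //; exists setT => //; rewrite setXTT.
- move=> _ [X1 mX1 [X2 mX2 <-]].
  pose B' X j := if j == i then X else B j.
  have mB' X : measurable X -> forall j, measurable (B' X j).
    by move=> mX j; rewrite /B'; case: ifP.
  have evB' X : ev (B' X) m = U i @^-1` X `&` ev B m.+1.
    rewrite (evS _ i) /B' eqxx; congr (_ `&` _).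
    apply: eq_bigcapr => j _; have [->|//] := eqVneq j i.
    by rewrite ltnn.
  have PevB' X : measurable X -> P (ev (B' X) m) = P (U i @^-1` X) * P (ev B m.+1).
    move=> mX; rewrite (PevS _ i); last exact: mB'.
    rewrite /B' eqxx; congr (_ * _); rewrite !Pev//; last first.
      by move=> j; case: ifP.
    by apply: eq_bigr => j _; have [->|//] := eqVneq j i; rewrite ltnn.
  have -> : W @^-1` (X1 `*` X2) = psum m @^-1` X1 `&` U i @^-1` X2 by [].
  rewrite -setIA -evB' IH//; [|exact: ltnW|exact: mB'].
  rewrite PevB'// muleA; congr (_ * _).
  (* Full sides at the other indices turn the future event into a constraint on [U i] alone. *)
  pose Bt j := if j == i then X2 else setT : set (n.-tuple R).
  have mBt j : measurable (Bt j) by rewrite /Bt; case: ifP.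
  have evBt : ev Bt m = U i @^-1` X2.
    rewrite (evS _ i) /Bt eqxx; apply/setIidPl => t _ j _.
    by case: ifP => // ij; case: eqP => // ji; rewrite ji ltnn in ij.
  by rewrite -evBt IH// ltnW.
- by rewrite -[X in measurable X]setTI; exact: measurable_tadd.
Qed.

Lemma psum_indep (i : 'I_k) : indep_pair (psum i) (U i).
Proof.
move=> A B mA mB.
pose Bt j := if j == i then B else setT : set (n.-tuple R).
have mBt j : measurable (Bt j) by rewrite /Bt; case: ifP.
have evBt : ev Bt i = U i @^-1` B.
  rewrite evS /Bt eqxx; apply/setIidPl => t _ j _.
  by case: ifP => // ij; case: eqP => // ji; rewrite ji ltnn in ij.
by rewrite -evBt psum_indep_ev// ltnW.
Qed.

(** A supermartingale argument: independence allows the partial sum to be frozen as the constant [x]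
    while the next summand is averaged. *)
Lemma psum_chain (h : nat -> n.-tuple R -> \bar R) :
  (forall m, measurable_fun setT (h m)) -> (forall m x, 0 <= h m x) ->
  (forall (i : 'I_k) x, \int[P]_t h i.+1 (tadd x (U i t)) <= h i x) ->
  \int[P]_t h k (psum k t) <= h 0%N [tuple 0%R | c < n].
Proof.
move=> mh h0 hS.
suff H m : (m <= k)%N -> \int[P]_t h m (psum m t) <= h 0%N [tuple 0%R | c < n].
  exact: H.
elim: m => [|m IH] mk.
  under eq_integral do rewrite psum0.
  rewrite integral_cst// [X in _ * X](_ : _ = 1) ?mule1//; exact: probability_setT.
apply: le_trans (IH (ltnW mk)); pose i := Ordinal mk.
pose f (z : n.-tuple R * n.-tuple R) := h m.+1 (tadd z.1 z.2).
have mf : measurable_fun setT f by apply: measurableT_comp => //; exact: measurable_tadd.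
have f0 z : 0 <= f z by exact: h0.
rewrite (_ : \int[P]_t h m.+1 (psum m.+1 t) = \int[P]_t f (psum m t, U i t)); last first.
  by apply: eq_integral => t _; rewrite /f (psumS i).
have mpsum := measurable_psum m.
rewrite (ge0_integral_indep _ _ _ mpsum (mU i) (psum_indep i) mf f0).
pose g x := \int[P]_s f (x, U i s).
apply: ge0_le_integral => //.
- by move=> t _; apply: integral_ge0.
- have mg : measurable_fun setT g.
    pose fU (z : n.-tuple R * T) := f (z.1, U i z.2).
    have mfU : measurable_fun setT fU.
      apply: (measurableT_comp mf); apply: measurable_fun_pair => //.
      exact: (measurableT_comp (mU i)).
    by apply: (measurable_fun_fubini_tonelli_F (m2 := P) fU) => // z; exact: f0.
  exact: (measurableT_comp mg).
- exact: measurableT_comp.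
- by move=> t _; exact: (hS i).
Qed.

End PartialSums.

(** * Tail bound for sums of subgaussian vectors *)

(** Put t = 2 theta rho / (b' M), so that b = b' (1 - t). Then ln (1 - t) <= - t pays for the term
    theta rho / b', and (1 + t) (1 - t) <= 1 settles the terms in [q], which stands for |x|^2. *)
Lemma potential_step {R : realType} (M theta b b' rho q : R) :
  0 < M -> 0 <= theta -> 0 < b -> 0 <= rho -> 0 <= q ->
  b = b' - 2 * theta * rho / M ->
  - (M / 2) * ln b' + theta / b' * (rho + q) + rho * (4 * (theta / b') ^+ 2 * q) / (2 * M)
    <= - (M / 2) * ln b + theta / b * q.
Proof.
move=> M0 th0 b0 r0 q0 bE.
have b'0 : 0 < b'.
  rewrite (_ : b' = b + 2 * theta * rho / M); last by rewrite bE; ring.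
  by apply: ltr_wpDr => //; rewrite divr_ge0 ?mulr_ge0// ltW.
have lnb : ln b - ln b' <= - (2 * (theta / b') * rho / M).
  rewrite -ln_div ?posrE//.
  have -> : b / b' = 1 + - (2 * (theta / b') * rho / M).
    by rewrite bE; field; rewrite !gt_eqF.
  apply: le_ln1Dx.
  have -> : - (2 * (theta / b') * rho / M) = b / b' - 1.
    by rewrite bE; field; rewrite !gt_eqF.
  by have : 0 < b / b'; [exact: divr_gt0|lra].
have lnM2 : (M / 2) * (ln b - ln b') <= - (theta / b' * rho).
  have -> : - (theta / b' * rho) = (M / 2) * - (2 * (theta / b') * rho / M).
    by field; rewrite !gt_eqF.
  by apply: ler_wpM2l => //; rewrite divr_ge0// ltW.
suff H : theta / b' * q + rho * (4 * (theta / b') ^+ 2 * q) / (2 * M) <= theta / b * q.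
  move: lnM2 H; rewrite mulrBr mulrDr !mulNr.
  set x := M / 2 * _; set y := M / 2 * _; set z := _ / (2 * M); lra.
have -> : theta / b' * q + rho * (4 * (theta / b') ^+ 2 * q) / (2 * M) =
    theta / b' * (1 + 2 * theta * rho / (b' * M)) * q.
  by field; rewrite !gt_eqF.
apply: ler_wpM2r => //; rewrite -mulrA; apply: ler_wpM2l => //.
rewrite -[leRHS]mul1r ler_pdivlMr//.
have tE : b = b' * (1 - 2 * theta * rho / (b' * M)).
  by rewrite bE; field; rewrite !gt_eqF.
rewrite tE; set t := 2 * theta * rho / (b' * M).
have -> : b'^-1 * (1 + t) * (b' * (1 - t)) = 1 - t ^+ 2.
  by field; rewrite gt_eqF.
by rewrite lerBlDr lerDl sqr_ge0.
Qed.

Lemma tsq_tadd {R : realType} n (x y : n.-tuple R) :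
  tsq (tadd x y) = tsq x + tsq y + 2 * \sum_(c < n) tnth x c * tnth y c.
Proof.
rewrite /tsq mulr_sumr -!big_split/=; apply: eq_bigr => c _.
by rewrite tnth_mktuple; ring.
Qed.

Lemma tsq_ge0 {R : realType} n (x : n.-tuple R) : 0 <= tsq x.
Proof. by apply: sumr_ge0 => c _; exact: sqr_ge0. Qed.

Lemma subgaussian_sum_tail {R : realType} {d : measure_display} {T : measurableType d}
    (P : probability T R) n k (U : 'I_k -> T -> n.-tuple R) (M alpha : R)
    (rho : 'I_k -> R) :
  0 < M -> 0 < alpha -> alpha < 1 ->
  mutually_independent P U ->
  (forall i t, tsq (U i t) <= rho i) ->
  (forall i (x : n.-tuple R),
    (\int[P]_t (expR (\sum_(c < n) tnth x c * tnth (U i t) c)%R)%:E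
      <= (expR (rho i * tsq x / (2 * M)))%:E)%E) ->
  \sum_i rho i <= alpha ^+ 2 ->
  (P [set t | (1 <= \sum_(c < n) (\sum_(i < k) tnth (U i t) c) ^+ 2)%R]
    <= (expR (- (M / 2) * (alpha ^- 2 - ln (alpha ^- 2) - 1)))%:E)%E.
Proof.
move=> M0 a0 a1 indU Urho Uexp rhoa.
(* A sample point exists because [P] has mass 1; it turns |U_i|^2 <= rho_i into rho_i >= 0. *)
have [t0 _] : [set: T] !=set0.
  apply/set0P/eqP => T0; have := probability_setT P.
  by rewrite T0 measure0 => /eqP; rewrite eqe eq_sym oner_eq0.
have rho0 i : 0 <= rho i by exact: le_trans (tsq_ge0 _ _) (Urho i t0).
have a20 : 0 < alpha ^+ 2 by rewrite exprn_gt0.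
have a2V : 0 < alpha ^- 2 by rewrite invr_gt0.
(* The minimiser of - theta - (M / 2) ln (1 - 2 theta alpha^2 / M), the exponent left by Markov's
   inequality when the [rho i] sum to alpha^2. At this point the argument of the logarithm is
   alpha^2. *)
pose theta := M / 2 * (alpha ^- 2 - 1).
have th0 : 0 <= theta.
  rewrite mulr_ge0 ?divr_ge0 ?(ltW M0)// subr_ge0 invf_ge1//.
  by rewrite exprn_ile1// ltW.
(* The sum runs over the summands still to be added, so [b] grows from [b 0 >= alpha ^+ 2] to
   [b k = 1]. *)
pose b m := 1 - 2 * theta / M * \sum_(i < k) (if (m <= i)%N then rho i else 0).
have b_ge m : alpha ^+ 2 <= b m.
  have le1 : \sum_(i < k) (if (m <= i)%N then rho i else 0) <= alpha ^+ 2.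
    by apply: le_trans rhoa; apply: ler_sum => i _; case: ifP.
  have thM : 2 * theta / M = alpha ^- 2 - 1 by rewrite /theta; field; rewrite !gt_eqF.
  rewrite /b thM lerBrDr -lerBrDl.
  apply: le_trans (_ : (alpha ^- 2 - 1) * alpha ^+ 2 <= _).
    by apply: ler_wpM2l => //; rewrite subr_ge0 invf_ge1// exprn_ile1// ltW.
  by rewrite mulrBl mulVf ?gt_eqF// mul1r.
have b0 m : 0 < b m by exact: lt_le_trans a20 (b_ge m).
(* For [n = M], [h m x] is [E exp (theta |x + G_m + ... + G_(k-1)|^2)] for
   independent Gaussian [G_i] of covariance [rho i / M]; it dominates the same
   expectation for the [U i]. *)
pose h m (x : n.-tuple R) := (expR (- (M / 2) * ln (b m) + theta / b m * tsq x))%:E.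
have mh m : measurable_fun setT (h m).
  apply/measurable_EFinP; apply: measurableT_comp => //.
  apply: measurable_funD => //; apply: measurable_funM => //; exact: measurable_tsq.
have h0 m x : (0 <= h m x)%E by rewrite lee_fin expR_ge0.
have mUc i c : measurable_fun setT (fun t => tnth (U i t) c).
  by apply: (measurableT_comp (measurable_tnth_real _ c)); case: indU.
have hS (i : 'I_k) x : (\int[P]_t h i.+1 (tadd x (U i t)) <= h i x)%E.
  have bS : b i = b i.+1 - 2 * theta * rho i / M.
    have -> : b i.+1 = 1 - 2 * theta / M *
        \sum_(j < k | j != i) (if (i <= j)%N then rho j else 0).
      rewrite /b (bigD1 i)//= ltnn add0r; congr (1 - _ * _).
      apply: eq_bigr => j ji.
      by rewrite ltn_neqAle -[(nat_of_ord i == j)]/(i == j) eq_sym ji.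
    by rewrite /b (bigD1 i)//= leqnn; ring.
  (* c |x + U_i|^2 splits into c |x|^2, c |U_i|^2 <= c rho_i and the linear term <2 c x, U_i>. [K]
     collects the constants and [y] is 2 c x. *)
  pose c := theta / b i.+1.
  pose K := - (M / 2) * ln (b i.+1) + c * (rho i + tsq x).
  pose y : n.-tuple R := [tuple 2 * c * tnth x j | j < n].
  have c0 : 0 <= c by rewrite divr_ge0// ltW.
  have my : measurable_fun setT (fun t => (expR (\sum_j tnth y j * tnth (U i t) j)%R)%:E).
    apply/measurable_EFinP; apply: measurableT_comp => //.
    by apply: measurable_sum => j; exact: measurable_funM.
  apply: (@le_trans _ _
    (\int[P]_t ((expR K)%:E * (expR (\sum_j tnth y j * tnth (U i t) j)%R)%:E))%E).
    apply: ge0_le_integral => //.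
    - apply: (measurableT_comp (mh i.+1)).
      apply: (@measurableT_comp _ _ _ _ _ _ (tadd x) _ (U i)); last by case: indU.
      exact: (measurable_fun_pair2 x (measurable_tadd n)).
    - exact: emeasurable_funM.
    - move=> t _; rewrite lee_fin -expRD ler_expR tsq_tadd /K -!addrA lerD2l.
      have -> : \sum_j tnth y j * tnth (U i t) j =
          2 * c * \sum_j tnth x j * tnth (U i t) j.
        by rewrite mulr_sumr; apply: eq_bigr => j _; rewrite tnth_mktuple mulrA.
      have := ler_wpM2l c0 (Urho i t); rewrite -/c.
      set s := \sum_j _; move: (tsq _) (tsq _) => p q; nra.
  rewrite ge0_integralZl_EFin ?expR_ge0//.
  apply: (@le_trans _ _ ((expR K)%:E * (expR (rho i * tsq y / (2 * M)))%:E)%E).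
    by apply: lee_wpmul2l => //; rewrite lee_fin expR_ge0.
  rewrite -EFinM -expRD lee_fin ler_expR.
  have -> : tsq y = 4 * c ^+ 2 * tsq x.
    rewrite /tsq mulr_sumr; apply: eq_bigr => j _; rewrite tnth_mktuple; ring.
  by apply: potential_step => //; exact: tsq_ge0.
have := psum_chain P n k U indU h mh h0 hS.
set F := [set t | _]; set Z := psum n k U k.
have ZE t : tsq (Z t) = \sum_(c < n) (\sum_(i < k) tnth (U i t) c) ^+ 2.
  rewrite /tsq; apply: eq_bigr => c _; rewrite tnth_mktuple; congr (_ ^+ 2).
  by apply: eq_bigr => i _; rewrite ltn_ord.
have mZ : measurable_fun setT Z by exact: (measurable_psum P _ _ _ indU).
have mF : measurable F.
  have -> : F = (fun t => tsq (Z t)) @^-1` `[1, +oo[.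
    by apply/seteqP; split => t; rewrite /F /= ZE in_itv/= andbT.
  apply: preimage_measurable => //; apply: measurableT_comp => //.
  exact: measurable_tsq.
move=> HZ.
have bk : b k = 1.
  by rewrite /b big1 ?mulr0 ?subr0// => i _; rewrite leqNgt ltn_ord.
have lnb0 : - (M / 2) * ln (b 0%N) <= - (M / 2) * ln (alpha ^+ 2).
  rewrite !mulNr lerN2; apply: ler_wpM2l; first by rewrite divr_ge0// ltW.
  by rewrite ler_ln ?posrE.
(* Markov's inequality: since [b k = 1], the final potential is at least [expR theta] on [F]. *)
have : ((expR theta)%:E * P F <= (expR (- (M / 2) * ln (alpha ^+ 2)))%:E)%E.
  apply: (@le_trans _ _ (\int[P]_(t in F) h k (Z t))%E).
    rewrite -(integral_cst P mF); apply: ge0_le_integral => //.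
    - by move=> t _ /=; rewrite lee_fin expR_ge0.
    - by apply: measurable_funTS; apply: measurableT_comp.
    - move=> t Ft /=; rewrite lee_fin ler_expR bk ln1 mulr0 add0r divr1.
      by rewrite ler_peMr// ZE.
  apply: (@le_trans _ _ (\int[P]_t h k (Z t))%E).
    by apply: ge0_subset_integral => //; exact: measurableT_comp.
  apply: le_trans HZ _; rewrite /h lee_fin ler_expR /tsq big1 ?mulr0 ?addr0//.
  by move=> c _; rewrite tnth_mktuple expr0n.
rewrite -lee_pdivlMl ?expR_gt0// -EFinM -expRN -expRD.
move=> /le_trans; apply; rewrite lee_fin ler_expR lnV ?posrE// /theta.
by set l := ln _; lra.
Qed.

(** * Moments of isotropic vectors *)

Section Bounded.
Context {R : realType} {d : measure_display} {T : measurableType d}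
  (P : probability T R).

(** Stable under sums, products and powers, so polynomials in the coordinates of a vector of length
    at most 1 are integrable at once. *)
Definition bounded_rv (f : T -> R) :=
  measurable_fun setT f /\ exists K : R, forall t, `|f t| <= K.

Definition mean (f : T -> R) : R := \int[P]_t f t.

Lemma bounded_rv_integrable f : bounded_rv f -> P.-integrable setT (EFin \o f).
Proof.
move=> [mf [K fK]]; apply: measurable_bounded_integrable => //.
  by apply: (@le_lt_trans _ _ 1%E); [exact: probability_le1|exact: ltry].
by exists K; split; [exact: num_real|move=> x Kx t _; exact: le_trans (fK t) (ltW Kx)].
Qed.

Lemma bounded_rv_cst r : bounded_rv (cst r).
Proof. by split => //; exists `|r|. Qed.

Lemma bounded_rvD f g : bounded_rv f -> bounded_rv g -> bounded_rv (fun t => f t + g t).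
Proof.
move=> [mf [K fK]] [mg [L gL]]; split; first exact: measurable_funD.
by exists (K + L) => t; rewrite (le_trans (ler_normD _ _))// lerD.
Qed.

Lemma bounded_rvM f g : bounded_rv f -> bounded_rv g -> bounded_rv (fun t => f t * g t).
Proof.
move=> [mf [K fK]] [mg [L gL]]; split; first exact: measurable_funM.
by exists (K * L) => t; rewrite normrM ler_pM.
Qed.

Lemma bounded_rvX f p : bounded_rv f -> bounded_rv (fun t => f t ^+ p).
Proof.
move=> bf; elim: p => [|p IH]; first exact: bounded_rv_cst.
by have := bounded_rvM _ _ bf IH; congr bounded_rv; apply/funext => t; rewrite exprS.
Qed.

Lemma bounded_rv_sum I (r : seq I) (F : I -> T -> R) :
  (forall i, bounded_rv (F i)) -> bounded_rv (fun t => \sum_(i <- r) F i t).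
Proof.
move=> bF; elim: r => [|i r IH].
  by have := bounded_rv_cst 0; congr bounded_rv; apply/funext => t; rewrite big_nil.
have := bounded_rvD _ _ (bF i) IH.
by congr bounded_rv; apply/funext => t; rewrite big_cons.
Qed.

Lemma mean_cst r : mean (cst r) = r.
Proof.
rewrite /mean Rintegral_cst// (_ : fine _ = 1) ?mulr1//.
by rewrite [X in fine X](_ : _ = 1%E)//; exact: probability_setT.
Qed.

Lemma meanD f g : bounded_rv f -> bounded_rv g ->
  mean (fun t => f t + g t) = mean f + mean g.
Proof. by move=> bf bg; apply: RintegralD => //; exact: bounded_rv_integrable. Qed.

Lemma meanZ r f : bounded_rv f -> mean (fun t => r * f t) = r * mean f.
Proof. by move=> bf; apply: RintegralZl => //; exact: bounded_rv_integrable. Qed.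

Lemma mean_sum I (r : seq I) (F : I -> T -> R) : (forall i, bounded_rv (F i)) ->
  mean (fun t => \sum_(i <- r) F i t) = \sum_(i <- r) mean (F i).
Proof.
move=> bF; elim: r => [|i r IH].
  rewrite big_nil -[RHS](mean_cst 0); congr mean.
  by apply/funext => t; rewrite big_nil.
rewrite big_cons -IH -meanD//; last exact: bounded_rv_sum.
by congr mean; apply/funext => t; rewrite big_cons.
Qed.

Lemma ler_mean f g : bounded_rv f -> bounded_rv g -> (forall t, f t <= g t) ->
  mean f <= mean g.
Proof.
by move=> bf bg fg; apply: le_Rintegral => //; exact: bounded_rv_integrable.
Qed.

Lemma mean_ge0 f : (forall t, 0 <= f t) -> 0 <= mean f.
Proof. by move=> f0; apply: Rintegral_ge0. Qed.

Lemma EFin_mean f : bounded_rv f -> ((mean f)%:E = \int[P]_t (f t)%:E)%E.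
Proof.
move=> /bounded_rv_integrable intf; rewrite /mean /Rintegral fineK//.
exact: integrable_fin_num.
Qed.

End Bounded.

Lemma poly_eq_horner {R : realFieldType} (p q : {poly R}) :
  (forall y, p.[y] = q.[y]) -> p = q.
Proof.
move=> pq; apply/eqP; rewrite -subr_eq0; apply/negPn/negP => r0.
(* The numbers 0, ..., [size r] - 1 are one root more than the degree of [r] allows. *)
set r := p - q in r0; pose s := [seq n%:R : R | n <- iota 0 (size r)].
have := max_poly_roots r0 (rs := s); rewrite size_map size_iota ltnn => H.
suff : false by []; apply: H.
  apply/allP => _ /mapP[n _ ->]; rewrite rootE /r hornerD hornerN pq.
  by rewrite subrr.
rewrite map_inj_uniq ?iota_uniq// => m n /eqP; rewrite eqr_nat => /eqP. exact.
Qed.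

Section Sphere.
Context {R : realType} {d : measure_display} {T : measurableType d}
  (P : probability T R) (M : nat) (s : T -> M.-tuple R).
Local Notation mean := (mean P).

Definition ip (w : 'I_M -> R) (t : T) : R := \sum_(j < M) w j * tnth (s t) j.

(** Rotation invariance seen through linear functionals, the form in which both the Gaussian and the
    spherical rows can supply it. *)
Definition isotropic := forall u w : 'I_M -> R,
  \sum_j u j ^+ 2 = \sum_j w j ^+ 2 ->
  forall B : set R, measurable B -> P (ip u @^-1` B) = P (ip w @^-1` B).

Hypotheses (ms : measurable_fun setT s) (s1 : forall t, tsq (s t) <= 1)
  (iso : isotropic).

Let x j t := tnth (s t) j.

Let mx j : measurable_fun setT (x j).
Proof. exact: (measurableT_comp (measurable_tnth_real _ j)). Qed.

Lemma measurable_ip w : measurable_fun setT (ip w).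
Proof. by apply: measurable_sum => j; apply: measurable_funM => //; exact: mx. Qed.

Let bx j : bounded_rv (x j).
Proof.
split => //; exists 1 => t; rewrite -(@ler_pXn2r _ 2)// ?nnegrE// expr1n.
rewrite -normrX ger0_norm ?sqr_ge0//; apply: le_trans (s1 t).
by rewrite /tsq (bigD1 j)//= lerDl sumr_ge0// => i _; exact: sqr_ge0.
Qed.

Let bip w : bounded_rv (ip w).
Proof.
by apply: bounded_rv_sum => j; apply: bounded_rvM; [exact: bounded_rv_cst|exact: bx].
Qed.

Lemma isotropic_integral u w (f : R -> \bar R) :
  \sum_j u j ^+ 2 = \sum_j w j ^+ 2 -> measurable_fun setT f ->
  (forall r, 0 <= f r)%E ->
  (\int[P]_t f (ip u t) = \int[P]_t f (ip w t))%E.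
Proof.
move=> uw mf f0.
pose X v : {mfun T >-> R} :=
  HB.pack (ip v) (isMeasurableFun.Build _ _ _ _ (ip v) (measurable_ip v)).
rewrite -[LHS](ge0_integral_distribution (X u) mf f0).
rewrite -[RHS](ge0_integral_distribution (X w) mf f0).
by apply: eq_measure_integral => A mA _; exact: iso.
Qed.

Let even_ge0 p (y : R) : 0 <= y ^+ p.*2.
Proof. by rewrite -mul2n exprM exprn_ge0// sqr_ge0. Qed.

Lemma isotropic_moment u w p : \sum_j u j ^+ 2 = \sum_j w j ^+ 2 ->
  mean (fun t => ip u t ^+ p.*2) = mean (fun t => ip w t ^+ p.*2).
Proof.
move=> uw; apply: EFin_inj; rewrite !EFin_mean; [|exact: bounded_rvX..].
apply: (isotropic_integral u w (fun r => (r ^+ p.*2)%:E)) => //.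
- by apply/measurable_EFinP; exact: exprn_measurable.
- by move=> r; rewrite lee_fin.
Qed.

Lemma ip_delta i c t : ip (fun j => if j == i then c else 0) t = c * x i t.
Proof.
rewrite /ip (bigD1 i)//= eqxx big1 ?addr0// => j /negbTE ->; exact: mul0r.
Qed.

Let sq_delta i (c : R) : \sum_(j < M) (if j == i then c else 0) ^+ 2 = c ^+ 2.
Proof.
by rewrite (bigD1 i)//= eqxx big1 ?addr0// => j /negbTE ->; rewrite expr0n.
Qed.

(** [w] has the same length as |w| e_i, so isotropy trades the functional for a multiple of one
    coordinate. *)
Lemma moment_norm w i p : mean (fun t => ip w t ^+ p.*2) =
  (\sum_j w j ^+ 2) ^+ p * mean (fun t => x i t ^+ p.*2).
Proof.
have w0 : 0 <= \sum_j w j ^+ 2 by apply: sumr_ge0 => j _; exact: sqr_ge0.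
pose c := Num.sqrt (\sum_j w j ^+ 2).
rewrite (isotropic_moment w (fun j => if j == i then c else 0)); last first.
  by rewrite sq_delta /c sqr_sqrtr.
rewrite -meanZ; last exact: bounded_rvX.
congr mean; apply/funext => t; rewrite ip_delta exprMn; congr (_ * _).
by rewrite -mul2n exprM sqr_sqrtr.
Qed.

Lemma cross_moment i j p : j != i ->
  (p.*2.+1)%:R * mean (fun t => x i t ^+ p.*2 * x j t ^+ 2) =
  mean (fun t => x i t ^+ p.+1.*2).
Proof.
move=> ji; set m := RHS.
pose a k := 'C(p.+1.*2, k)%:R * mean (fun t => x i t ^+ (p.+1.*2 - k) * x j t ^+ k).
have ba k : bounded_rv (fun t => x i t ^+ (p.+1.*2 - k) * x j t ^+ k).
  by apply: bounded_rvM; exact: bounded_rvX.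
(* Two polynomials in [y] for the mean of (x_i + y x_j)^(2p+2): the binomial expansion, and the
   moment formula with |w|^2 = 1 + y^2. *)
pose q1 : {poly R} := \poly_(k < p.+1.*2.+1) a k.
pose q2 : {poly R} := m *: (1 + 'X^2) ^+ p.+1.
have q12 : q1 = q2.
  apply: poly_eq_horner => y.
  pose w l : R := if l == i then 1 else if l == j then y else 0.
  have wE (F : 'I_M -> R -> R) : (forall l, F l 0 = 0) ->
      \sum_l F l (w l) = F i 1 + F j y.
    move=> F0; rewrite (bigD1 i)//= (bigD1 j)//= /w eqxx (negbTE ji) eqxx.
    rewrite big1 ?addr0// => l /andP[li lj].
    by rewrite (negbTE li) (negbTE lj) F0.
  have := moment_norm w i p.+1.
  rewrite (wE (fun _ r => r ^+ 2)); last by move=> l; rewrite expr0n.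
  rewrite -/m expr1n.
  have -> : (fun t => ip w t ^+ p.+1.*2) =
      (fun t => \sum_(k < p.+1.*2.+1)
        ('C(p.+1.*2, k)%:R * y ^+ k) * (x i t ^+ (p.+1.*2 - k) * x j t ^+ k)).
    apply/funext => t; rewrite /ip (wE (fun l r => r * tnth (s t) l)); last first.
      by move=> l; rewrite mul0r.
    rewrite mul1r exprDn; apply: eq_bigr => k _.
    by rewrite exprMn -mulr_natl /x; ring.
  rewrite mean_sum; last by move=> k; apply: bounded_rvM; [exact: bounded_rv_cst|exact: ba].
  rewrite horner_poly /q2 hornerZ horner_exp hornerD hornerXn hornerC.
  rewrite [in RHS]mulrC => <-.
  by apply: eq_bigr => k _; rewrite meanZ// /a; ring.
(* The coefficient of y^2 carries the binomial (p+1)(2p+1) on one side and p+1 on the other; p+1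
   cancels. *)
have := congr1 (fun q : {poly R} => q`_2) q12.
rewrite /q1 /q2 coef_poly coefZ exprDn coef_sum.
rewrite (_ : (2 < _)%N = true); last by rewrite doubleS.
rewrite (bigD1 (Ordinal (isT : (1 < p.+2)%N)))//= big1 ?addr0; last first.
  move=> k k1; rewrite coefMn expr1n mul1r -exprM coefXn.
  rewrite (_ : (2 == 2 * k)%N = false) ?mul0rn//.
  by case: k k1 => -[|[|k]] // k2 _; rewrite mulnS.
rewrite coefMn expr1n mul1r expr1 coefXn eqxx bin1 /a.
have -> : (p.+1.*2 - 2 = p.*2)%N by rewrite doubleS subSS subSS subn0.
have -> : 'C(p.+1.*2, 2) = (p.+1 * p.*2.+1)%N.
  by rewrite bin2 -doubleMl doubleK doubleS.
rewrite natrM -mulrA -[_%:R *+ _]/(1 *+ p.+1) [RHS]mulrC.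
by apply: mulfI; rewrite pnatr_eq0.
Qed.

(** Multiply |s|^2 <= 1 by (2p+1) x_i^(2p) and average. By [cross_moment] each of the M - 1 terms
    with j != i gives E x_i^(2p+2), and the diagonal term gives 2p+1 times it. The resulting factor
    M + 2p is weakened to M. *)
Lemma moment_step i p :
  M%:R * mean (fun t => x i t ^+ p.+1.*2) <=
  p.*2.+1%:R * mean (fun t => x i t ^+ p.*2).
Proof.
set m := mean _; set m' := mean _.
have bcross j : bounded_rv (fun t => x i t ^+ p.*2 * x j t ^+ 2).
  by apply: bounded_rvM; exact: bounded_rvX.
have m0 : 0 <= m by apply: mean_ge0 => t.
have sum_le : \sum_j mean (fun t => x i t ^+ p.*2 * x j t ^+ 2) <= m'.
  rewrite -mean_sum//; apply: ler_mean; [exact: bounded_rv_sum|exact: bounded_rvX|].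
  by move=> t; rewrite -mulr_sumr ler_piMr//; exact: s1.
have : p.*2.+1%:R * \sum_j mean (fun t => x i t ^+ p.*2 * x j t ^+ 2) <= p.*2.+1%:R * m'.
  exact: ler_wpM2l.
apply: le_trans; rewrite (bigD1 i)//= mulrDr mulr_sumr.
rewrite (eq_bigr (fun=> m)); last by move=> j ji; rewrite cross_moment.
rewrite sumr_const cardC1 card_ord.
have -> : mean (fun t => x i t ^+ p.*2 * x i t ^+ 2) = m.
  by congr mean; apply/funext => t; rewrite -exprD doubleS addn2.
have M1 : (0 < M)%N by apply: leq_ltn_trans (ltn_ord i).
rewrite -{1}(prednK M1) -(mulr_natl m M.-1) -addn1 natrD mulrDl mul1r [leRHS]addrC lerD2l.
by rewrite ler_peMl// ler1n.
Qed.

(** The bound is the moment of order 2p of a centred normal variable of variance 1 / M. *)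
Lemma moment_bound i p :
  mean (fun t => x i t ^+ p.*2) <= p.*2`!%:R / ((2 * M%:R) ^+ p * p`!%:R).
Proof.
have M0 : 0 < M%:R :> R by rewrite ltr0n (leq_ltn_trans _ (ltn_ord i)).
elim: p => [|p IH].
  by rewrite expr0 fact0 !mulr1 divr1 -[leRHS](mean_cst P).
have := moment_step i p; rewrite mulrC -ler_pdivlMr// => /le_trans; apply.
apply: (@le_trans _ _ (p.*2.+1%:R * (p.*2`!%:R / ((2 * M%:R) ^+ p * p`!%:R)) / M%:R)).
  apply: ler_wpM2r; first by rewrite invr_ge0 ltW.
  exact: ler_wpM2l.
rewrite doubleS !factS !natrM exprS le_eqVlt; apply/orP; left; apply/eqP.
have -> : p.*2.+2%:R = 2 * p.+1%:R :> R by rewrite -natrM mul2n doubleS.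
field; rewrite pnatr_eq0 -lt0n fact_gt0 nat1r pnatr_eq0 (gt_eqF M0).
by rewrite /= andbT expf_neq0// mulf_neq0// gt_eqF.
Qed.

End Sphere.

(** * From even moments to the exponential moment *)

(** The terms of the series of e^y + e^(-y). Odd powers cancel and the others are nonnegative, so
    even moments and monotone convergence are enough. *)
Definition sym_exp_coeff {R : realType} (y : R) (k : nat) : R :=
  (y ^+ k + (- y) ^+ k) / k`!%:R.

Lemma sym_exp_coeff_ge0 {R : realType} (y : R) k : 0 <= sym_exp_coeff y k.
Proof.
rewrite /sym_exp_coeff divr_ge0// exprNn -signr_odd -[k in y ^+ k]odd_double_half.
case: (odd k) => /=; first by rewrite mulN1r subrr.
by rewrite mul1r add0n addr_ge0// -mul2n exprM exprn_ge0// sqr_ge0.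
Qed.

Lemma sum_sym_exp_coeff_double {R : realType} (y : R) K :
  \sum_(0 <= k < K.*2) sym_exp_coeff y k =
  \sum_(0 <= p < K) (2 / p.*2`!%:R) * y ^+ p.*2.
Proof.
elim: K => [|K IH]; first by rewrite !big_nil.
rewrite doubleS !big_nat_recr//= IH /sym_exp_coeff -addrA; congr (_ + _).
have evenE : (- y) ^+ K.*2 = y ^+ K.*2 by rewrite -mul2n !exprM sqrrN.
rewrite !exprS evenE mulNr subrr mul0r addr0.
by ring.
Qed.

Lemma cvg_sum_sym_exp_coeff {R : realType} (y : R) :
  (fun K => \sum_(0 <= k < K) sym_exp_coeff y k) @ \oo --> expR y + expR (- y).
Proof.
have -> : (fun K => \sum_(0 <= k < K) sym_exp_coeff y k) =
    series (exp_coeff y) \+ series (exp_coeff (- y)).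
  apply/funext => K; rewrite /series /= -big_split/=; apply: eq_bigr => k _.
  by rewrite /exp_coeff /= /sym_exp_coeff mulrDl.
by apply: cvgD; exact: is_cvg_series_exp_coeff.
Qed.

Lemma isotropic_subgaussian {R : realType} {d : measure_display} {T : measurableType d}
    (P : probability T R) (M : nat) (s : T -> M.-tuple R) :
  (0 < M)%N -> measurable_fun setT s -> (forall t, tsq (s t) <= 1) ->
  isotropic P M s -> forall w : 'I_M -> R,
  (\int[P]_t (expR (ip M s w t))%:E <= (expR ((\sum_j w j ^+ 2) / (2 * M%:R)))%:E)%E.
Proof.
move=> M0 ms s1 iso w; pose i := Ordinal M0.
have MR : 0 < M%:R :> R by rewrite ltr0n.
set z := (\sum_j w j ^+ 2) / _.
have w0 : 0 <= \sum_j w j ^+ 2 by apply: sumr_ge0 => j _; exact: sqr_ge0.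
have z0 : 0 <= z by rewrite divr_ge0// mulr_ge0// ltW.
have mw := measurable_ip M s ms w.
have bip : bounded_rv (ip M s w).
  split=> //; exists (\sum_j `|w j|) => t.
  apply: le_trans (ler_norm_sum _ _ _) _; apply: ler_sum => j _.
  rewrite normrM ler_piMr// -(@ler_pXn2r _ 2)// ?nnegrE// expr1n.
  rewrite -normrX ger0_norm ?sqr_ge0//; apply: le_trans (s1 t).
  by rewrite /tsq (bigD1 j)//= lerDl sumr_ge0// => l _; exact: sqr_ge0.
have mexp (c : R) : measurable_fun setT (fun t => (expR (c * ip M s w t))%:E).
  apply/measurable_EFinP; apply: measurableT_comp => //; exact: measurable_funM.
(* [- w] has the length of [w], so <w, s> has a symmetric law. *)
have symm : (\int[P]_t (expR (- ip M s w t))%:E = \int[P]_t (expR (ip M s w t))%:E)%E.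
  rewrite -(isotropic_integral P M s ms iso (fun j => - w j) w (fun r => (expR r)%:E)).
  - apply: eq_integral => t _; congr (expR _)%:E.
    by rewrite /ip -sumrN; apply: eq_bigr => j _; rewrite mulNr.
  - by apply: eq_bigr => j _; rewrite sqrrN.
  - by apply/measurable_EFinP; exact: measurable_expR.
  - by move=> r; rewrite lee_fin expR_ge0.
have two : (\int[P]_t (expR (ip M s w t))%:E + \int[P]_t (expR (ip M s w t))%:E
    <= (2 * expR z)%:E)%E.
  rewrite -{2}symm -ge0_integralD//; last 2 first.
  - by have := mexp 1; under eq_fun do rewrite mul1r.
  - by have := mexp (-1); under eq_fun do rewrite mulN1r.
  pose g K t := (\sum_(0 <= k < K) sym_exp_coeff (ip M s w t) k)%:E.
  have mg K : measurable_fun setT (g K).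
    apply/measurable_EFinP; apply: measurable_sum => k.
    apply: measurable_funM => //; apply: measurable_funD; apply: measurable_funX => //.
    exact: measurableT_comp.
  have g0 K t : setT t -> (0 <= g K t)%E.
    by move=> _; rewrite lee_fin sumr_ge0// => k _; exact: sym_exp_coeff_ge0.
  have gnd t : setT t -> {homo g ^~ t : m n / (m <= n)%N >-> (m <= n)%E}.
    move=> _ m n mn; rewrite lee_fin (big_cat_nat (leq0n m) mn)//= lerDl.
    by rewrite sumr_ge0// => k _; exact: sym_exp_coeff_ge0.
  have gle K : (\int[P]_t g K t <= (2 * expR z)%:E)%E.
    (* Adding terms only increases the partial sum, and over an even number of terms the sum
       rewrites in even powers. *)
    have KK : (K <= K.*2)%N by rewrite -addnn leq_addr.
    apply: (@le_trans _ _ (\int[P]_t g K.*2 t)%E).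
      by apply: ge0_le_integral => // t _; [exact: g0|exact: gnd].
    have be p : bounded_rv (fun t => 2 / p.*2`!%:R * ip M s w t ^+ p.*2).
      by apply: bounded_rvM; [exact: bounded_rv_cst|exact: bounded_rvX].
    rewrite /g; under eq_integral do rewrite sum_sym_exp_coeff_double.
    rewrite -EFin_mean; last exact: bounded_rv_sum.
    rewrite lee_fin mean_sum//.
    apply: (@le_trans _ _ (\sum_(0 <= p < K) 2 * (z ^+ p / p`!%:R))).
      apply: ler_sum => p _; rewrite meanZ; last exact: bounded_rvX.
      rewrite (moment_norm P M s ms s1 iso w i).
      have F0 : 0 < p.*2`!%:R :> R by rewrite ltr0n fact_gt0.
      have := moment_bound P M s ms s1 iso i p.
      set m := mean _ _ => mle.
      apply: (@le_trans _ _ (2 / p.*2`!%:R *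
          ((\sum_j w j ^+ 2) ^+ p * (p.*2`!%:R / ((2 * M%:R) ^+ p * p`!%:R))))).
        apply: ler_wpM2l; first by rewrite divr_ge0// ltW.
        by apply: ler_wpM2l mle; exact: exprn_ge0.
      rewrite /z expr_div_n le_eqVlt; apply/orP; left; apply/eqP.
      field; rewrite (gt_eqF F0) /= pnatr_eq0 -lt0n fact_gt0/=.
      by rewrite expf_neq0// mulf_neq0// gt_eqF.
    rewrite -mulr_sumr ler_pM2l//.
    apply: (@nondecreasing_cvgn_le _ (series (exp_coeff z))) => //.
      move=> m n mn; rewrite /series /= (big_cat_nat (leq0n m) mn)//= lerDl.
      by rewrite sumr_ge0// => k _; rewrite exp_coeff_ge0.
    exact: is_cvg_series_exp_coeff.
  have glim t : ((expR (ip M s w t))%:E + (expR (- ip M s w t))%:E)%E =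
      limn (g ^~ t).
    apply/esym/cvg_lim => //; rewrite -EFinD.
    by apply/cvg_EFin; [exact: nearW|exact: cvg_sum_sym_exp_coeff].
  under eq_integral do rewrite glim.
  rewrite monotone_convergence//; apply: lime_le; last exact: nearW.
  apply: ereal_nondecreasing_is_cvgn => m n mn.
  by apply: ge0_le_integral => // t _; [exact: g0|exact: gnd].
(* An infinite integral would contradict [two]; a finite one is halved. *)
move: two; set I := (\int[P]_t _)%E.
have I0 : (0 <= I)%E by apply: integral_ge0 => t _; rewrite lee_fin expR_ge0.
case: I I0 => [r| |] //=; first by rewrite -EFinD !lee_fin => _; lra.
Qed.

(** * Rotation invariance of the normal distribution *)

Section NormalRotation.
Context {R : realType}.
Local Notation mu := (@lebesgue_measure R).
Local Notation normal := (normal_prob (0 : R) 1).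
Local Notation phi := (normal_pdf (0 : R) 1).
Local Open Scope ereal_scope.

Lemma lebesgue_measure_shift (a : R) (A : set R) : measurable A ->
  pushforward mu ((fun x => x + a)%R : _ -> measurableTypeR R) A = mu A.
Proof.
move=> mA.
have ma : measurable_fun setT
  ((fun x => x + a)%R : measurableTypeR R -> measurableTypeR R).
  exact: measurable_funD.
apply/esym/lebesgue_measure_unique => //= _ [[x y]] _ <-; rewrite /pushforward.
have -> : (fun z : R => z + a)%R @^-1` `]x, y]%classic =
    `](x - a)%R, (y - a)%R]%classic.
  by apply/seteqP; split => z /=; rewrite !in_itv/= ltrBlDr lerBrDr.
rewrite !lebesgue_measure_itv/= !lte_fin ltrD2r; case: ifP => // _.
by rewrite -!EFinB; congr _%:E; ring.
Qed.

Lemma integral_shift (f : R -> \bar R) (a : R) : measurable_fun setT f ->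
  (forall x, 0 <= f x) -> \int[mu]_x f (x + a)%R = \int[mu]_x f x.
Proof.
move=> mf f0.
have ma : measurable_fun setT
  ((fun x => x + a)%R : measurableTypeR R -> measurableTypeR R).
  exact: measurable_funD.
transitivity (\int[pushforward mu
    ((fun x => x + a)%R : measurableTypeR R -> measurableTypeR R)]_x f x).
  by rewrite ge0_integral_pushforward.
by apply: eq_measure_integral => //= A mA _; exact: lebesgue_measure_shift.
Qed.

(** The density is even and Lebesgue measure is invariant under reflection. *)
Lemma normal_probN (B : set R) : measurable B ->
  normal (-%R @^-1` B) = normal B.
Proof.
move=> mB; rewrite /normal_prob.
have mN : measurable_fun setT (-%R : measurableTypeR R -> measurableTypeR R) by [].
have mf : measurable_fun setT (fun x => (phi x)%:E).
  by apply/measurable_EFinP; exact: measurable_normal_pdf.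
transitivity (\int[mu]_(x in -%R @^-1` B) ((fun x => (phi x)%:E) \o -%R) x).
  apply: eq_integral => x _; rewrite /= !normal_pdfE ?oner_eq0//.
  by congr (_ * expR _)%:E; rewrite !subr0 sqrrN.
rewrite -(ge0_integral_pushforward mN)//; last 2 first.
- exact: measurable_funTS.
- by move=> x _; rewrite lee_fin normal_pdf_ge0.
by apply: eq_measure_integral => //= A mA _; exact: lebesgue_measureN.
Qed.

(** The change of variables yields the Radon-Nikodym derivative, which is identified with [phi] only
    almost everywhere. *)
Lemma integral_normal (f : R -> \bar R) : measurable_fun setT f ->
  (forall x, 0 <= f x) ->
  \int[normal]_x f x = \int[mu]_x (f x * (phi x)%:E).
Proof.
move=> mf f0; have dom := @normal_prob_dominates R 0%R 1%R.
rewrite -(Radon_Nikodym_SigmaFinite.change_of_variables dom)//.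
have mphi : measurable_fun setT (fun x => (phi x)%:E).
  by apply/measurable_EFinP; exact: measurable_normal_pdf.
have irn := Radon_Nikodym_SigmaFinite.f_integrable dom.
apply: ge0_ae_eq_integral => //.
- apply: emeasurable_funM => //; exact: (measurable_int mu irn).
- exact: emeasurable_funM.
- by move=> x _; rewrite mule_ge0// Radon_Nikodym_SigmaFinite.f_ge0.
- by move=> x _; rewrite mule_ge0// lee_fin normal_pdf_ge0.
apply: ae_eqe_mul2l; apply: integral_ae_eq => // E _ mE.
by rewrite -Radon_Nikodym_SigmaFinite.f_integral.
Qed.

(** An iterated integral, so that translation invariance can be applied directly to the inner
    variable. *)
Let I2 (F : R * R -> \bar R) := \int[mu]_x \int[mu]_y F (x, y).

Let measurable_rotation (c s : R) :
  measurable_fun setT (fun z : R * R => (c * z.1 - s * z.2, s * z.1 + c * z.2)%R).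
Proof.
apply: measurable_fun_pair.
  by apply: measurable_funB; apply: measurable_funM.
by apply: measurable_funD; apply: measurable_funM.
Qed.

Let shearY q F : measurable_fun setT F -> (forall z, 0 <= F z) ->
  I2 (fun z => F (z.1, z.2 + q * z.1)%R) = I2 F.
Proof.
move=> mF F0; apply: eq_integral => x _ /=.
exact: (integral_shift (fun y => F (x, y)) (q * x)%R (measurable_fun_pair2 x mF)).
Qed.

Let swap F : measurable_fun setT F -> (forall z, 0 <= F z) ->
  I2 F = \int[mu]_y \int[mu]_x F (x, y).
Proof. by move=> mF F0; exact: (fubini_tonelli (m1 := mu) (m2 := mu) F). Qed.

(** Tonelli moves the first variable inside, where it can be translated. *)
Let shearX p F : measurable_fun setT F -> (forall z, 0 <= F z) ->
  I2 (fun z => F (z.1 + p * z.2, z.2)%R) = I2 F.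
Proof.
move=> mF F0; rewrite !swap//.
  apply: eq_integral => y _ /=.
  exact: (integral_shift (fun x => F (x, y)) (p * y)%R (measurable_fun_pair1 y mF)).
apply: (measurableT_comp mF); apply: measurable_fun_pair => //.
by apply: measurable_funD => //; exact: measurable_funM.
Qed.

(* A rotation with [s <> 0] is a product of three shears, each of which
   preserves the Lebesgue measure by translation invariance in one variable. *)
Let rotation_integral (c s : R) F : (c ^+ 2 + s ^+ 2 = 1)%R -> s != 0%R ->
  measurable_fun setT F -> (forall z, 0 <= F z) ->
  I2 (fun z => F (c * z.1 - s * z.2, s * z.1 + c * z.2)%R) = I2 F.
Proof.
(* [p] is minus the tangent of half the angle: the rotation is a shear by [p] in the first variable,
   by [s] in the second, and again by [p] in the first. *)
move=> cs s0 mF F0; pose p := ((c - 1) / s)%R.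
have m1 (q : R) G : measurable_fun setT G ->
    measurable_fun setT (fun z : R * R => G (z.1 + q * z.2, z.2)%R : \bar R).
  move=> mG; apply: (measurableT_comp mG); apply: measurable_fun_pair => //.
  by apply: measurable_funD => //; exact: measurable_funM.
have m2 (q : R) G : measurable_fun setT G ->
    measurable_fun setT (fun z : R * R => G (z.1, z.2 + q * z.1)%R : \bar R).
  move=> mG; apply: (measurableT_comp mG); apply: measurable_fun_pair => //.
  by apply: measurable_funD => //; exact: measurable_funM.
pose F1 (z : R * R) := F (z.1 + p * z.2, z.2)%R.
pose F2 (z : R * R) := F1 (z.1, z.2 + s * z.1)%R.
have mF1 : measurable_fun setT F1 := m1 p F mF.
have mF2 : measurable_fun setT F2 := m2 s F1 mF1.
have <- : I2 (fun z => F2 (z.1 + p * z.2, z.2)%R) = I2 F.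
  exact: etrans (shearX p F2 mF2 (fun=> F0 _))
    (etrans (shearY s F1 mF1 (fun=> F0 _)) (shearX p F mF F0)).
congr I2; apply/funext => -[x y]; rewrite /F2 /F1 /=; congr (F (_, _)).
  have sc : (s * s = 1 - c * c)%R by rewrite -!expr2 -cs addrC addKr.
  rewrite (_ : (c * x - s * y = c * x - (s * s) / s * y)%R); last by rewrite mulfK.
  by rewrite sc /p; field.
by rewrite /p; field.
Qed.

Context {d : measure_display} {T : measurableType d} (P : probability T R).

Let pair_law (X Y : T -> R) (C : set (R * R)) :
  measurable_fun setT X -> measurable_fun setT Y ->
  (forall A B, measurable A -> measurable B ->
    P (X @^-1` A `&` Y @^-1` B) = normal A * normal B) ->
  measurable C ->
  P ((fun t => (X t, Y t)) @^-1` C) =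
    I2 (fun z => (\1_C z)%:E * (phi z.1 * phi z.2)%:E).
Proof.
move=> mX mY XY mC.
pose XY2 : T -> measurableTypeR R * measurableTypeR R := fun t => (X t, Y t).
have mXY : measurable_fun setT XY2 by exact: measurable_fun_pair.
pose Z : {mfun T >-> (measurableTypeR R * measurableTypeR R)%type} :=
  HB.pack XY2 (isMeasurableFun.Build _ _ _ _ _ mXY).
transitivity ((normal \x normal) C).
  rewrite -[LHS]/(distribution P Z C); apply/esym.
  by apply: product_measure_unique => // A B mA mB; exact: XY.
rewrite /product_measure1 integral_normal//; last exact: measurable_fun_xsection.
apply: eq_integral => x _ /=; rewrite muleC /normal_prob integral_mkcond.
have mxC : measurable (xsection C x) by exact: measurable_xsection.
rewrite -ge0_integralZl_EFin//; last 3 first.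
- by move=> y _; rewrite epatch_indic mule_ge0// lee_fin ?normal_pdf_ge0.
- apply/measurable_restrict => //; rewrite setTI.
  by apply/measurable_funTS/measurable_EFinP; exact: measurable_normal_pdf.
- exact: normal_pdf_ge0.
apply: eq_integral => y _; rewrite epatch_indic /=.
by rewrite !indicE mem_xsection EFinM muleA muleC.
Qed.

Definition normal_pair (X Y : T -> R) :=
  [/\ measurable_fun setT X, measurable_fun setT Y &
    forall A B, measurable A -> measurable B ->
      P (X @^-1` A `&` Y @^-1` B) = normal A * normal B].

(** The product density depends on x^2 + y^2 only, and the rotation preserves the planar Lebesgue
    measure. *)
Lemma normal_pair_rotation X Y (c s : R) A B : normal_pair X Y ->
  (c ^+ 2 + s ^+ 2 = 1)%R -> s != 0%R -> measurable A -> measurable B ->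
  P ((fun t => (X t, Y t)) @^-1`
      [set z | A (c * z.1 - s * z.2)%R /\ B (s * z.1 + c * z.2)%R]) =
    normal A * normal B.
Proof.
move=> [mX mY XY] cs s0 mA mB.
have mAB : measurable (A `*` B) by exact: measurableX.
have -> : normal A * normal B = P ((fun t => (X t, Y t)) @^-1` (A `*` B)).
  by rewrite -XY.
have -> : [set z : R * R | A (c * z.1 - s * z.2)%R /\ B (s * z.1 + c * z.2)%R] =
    (fun z : R * R => (c * z.1 - s * z.2, s * z.1 + c * z.2)%R) @^-1` (A `*` B) by [].
have mrot := measurable_rotation c s.
rewrite (pair_law X Y)//; last exact: preimage_measurable.
rewrite (pair_law X Y _ mX mY XY mAB).
pose F (z : R * R) := (\1_(A `*` B) z)%:E * (phi z.1 * phi z.2)%:E.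
have mF : measurable_fun setT F.
  apply: emeasurable_funM; apply/measurable_EFinP; first exact: measurable_indic.
  by apply: measurable_funM; apply: measurableT_comp => //; exact: measurable_normal_pdf.
have F0 z : 0 <= F z.
  by rewrite /F mule_ge0// lee_fin ?mulr_ge0//; exact: normal_pdf_ge0.
rewrite -[RHS](rotation_integral c s F cs s0 mF F0).
congr I2; apply/funext => -[x y]; rewrite /F /=; congr (_ * _%:E).
rewrite !normal_pdfE ?oner_eq0// /normal_fun !subr0.
rewrite [in LHS]mulrACA [in RHS]mulrACA -!expRD; congr (_ * expR _)%R.
rewrite -!mulrDl; congr (_ / _)%R; rewrite -!opprD; congr (- _)%R.
have -> : (x ^+ 2 + y ^+ 2 = (c ^+ 2 + s ^+ 2) * (x ^+ 2 + y ^+ 2))%R.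
  by rewrite cs mul1r.
ring.
Qed.

End NormalRotation.

(** * Rotations of an iid standard normal family *)

Section NormalFamily.
Context {R : realType} {d : measure_display} {T : measurableType d}
  (P : probability T R) (J : finType).
Local Notation normal := (normal_prob (0 : R) 1).
Local Open Scope ereal_scope.

(** Independence and marginal laws are merged, so a rotation has a single product rule to
    preserve. *)
Definition normal_family (g : J -> T -> R) :=
  (forall j, measurable_fun setT (g j)) /\
  forall B : J -> set R, (forall j, measurable (B j)) ->
    P (\bigcap_(j in [set: J]) (g j @^-1` B j)) = \prod_(j : J) normal (B j).

(** A Givens rotation in the plane of the coordinates [i] and [j]. *)
Definition rotate (i j : J) (c s : R) (g : J -> T -> R) (l : J) (t : T) : R :=
  if l == i then (c * g i t - s * g j t)%R
  else if l == j then (s * g i t + c * g j t)%R else g l t.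

(** Pulling a rectangle back through the rotation gives a set [C] that need not be a rectangle.
    Independence of the pair from the other coordinates is therefore extended to all planar sets,
    after which the planar case applies. *)
Lemma normal_family_rotate i j c s g : i != j -> (c ^+ 2 + s ^+ 2 = 1)%R ->
  s != 0%R -> normal_family g -> normal_family (rotate i j c s g).
Proof.
move=> ij cs s0 [mg Pg]; split=> [l|B mB].
  rewrite /rotate; case: eqP => _.
    by apply: measurable_funB; apply: measurable_funM.
  by case: eqP => // _; apply: measurable_funD; apply: measurable_funM.
have ji : j != i by rewrite eq_sym.
pose E := \bigcap_(l in [set: J]) (if (l == i) || (l == j) then setT else g l @^-1` B l).
have mE : measurable E.
  apply: bigcap_fin_measurable => l; case: ifP => // _; exact: preimage_measurable.
pose N := \prod_(l | (l != i) && (l != j)) normal (B l).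
pose W t := (g i t, g j t).
have mW : measurable_fun setT W by exact: measurable_fun_pair.
have split2 (F : J -> \bar R) :
    \prod_(l : J) F l = F i * F j * \prod_(l | (l != i) && (l != j)) F l.
  by rewrite (bigD1 i)//= (bigD1 j)//= muleA.
have PWE X1 X2 : measurable X1 -> measurable X2 ->
    P (W @^-1` (X1 `*` X2) `&` E) = normal X1 * normal X2 * N.
  move=> mX1 mX2.
  pose B' l := if l == i then X1 else if l == j then X2 else B l.
  have B'i : B' i = X1 by rewrite /B' eqxx.
  have B'j : B' j = X2 by rewrite /B' (negbTE ji) eqxx.
  have := Pg B'; rewrite split2 B'i B'j.
  rewrite (eq_bigr (fun l => normal (B l))); last first.
    by move=> l /andP[/negbTE li /negbTE lj]; rewrite /B' li lj.
  move=> <-; last by move=> l; rewrite /B'; do 2 case: ifP => // _.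
  congr (P _); apply/seteqP; split=> t /=.
    move=> [[t1 t2] Et] l _; rewrite /B'; have [->//|li] := eqVneq l i.
    have [->//|lj] := eqVneq l j.
    by have := Et l Logic.I; rewrite (negbTE li) (negbTE lj).
  move=> H; split; first split.
  - by have := H i Logic.I; rewrite B'i.
  - by have := H j Logic.I; rewrite B'j.
  - by move=> l _; have := H l Logic.I; rewrite /B'; do 2 case: eqP => //= _.
have PE : P E = N.
  have := PWE setT setT measurableT measurableT.
  by rewrite setXTT preimage_setT setTI !probability_setT !mul1e.
have PW X1 X2 : measurable X1 -> measurable X2 ->
    P (W @^-1` (X1 `*` X2)) = normal X1 * normal X2.
  move=> mX1 mX2; pose B' l := if l == i then X1 else if l == j then X2 else setT.
  have B'i : B' i = X1 by rewrite /B' eqxx.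
  have B'j : B' j = X2 by rewrite /B' (negbTE ji) eqxx.
  have := Pg B'; rewrite split2 B'i B'j.
  rewrite big1 ?mule1; last first.
    by move=> l /andP[/negbTE li /negbTE lj]; rewrite /B' li lj probability_setT.
  move=> <-; last by move=> l; rewrite /B'; do 2 case: ifP => // _.
  congr (P _); apply/seteqP; split=> t /=.
    move=> [t1 t2] l _; rewrite /B'; have [->//|li] := eqVneq l i.
    by have [->//|lj] := eqVneq l j.
  move=> H; split.
    by have := H i Logic.I; rewrite B'i.
  by have := H j Logic.I; rewrite B'j.
have pr : normal_pair P (g i) (g j) by split => // X1 X2 mX1 mX2; exact: PW.
pose C := [set z : R * R | B i (c * z.1 - s * z.2)%R /\ B j (s * z.1 + c * z.2)%R].
have mC : measurable C.
  have -> : C = (fun z : R * R => (c * z.1 - s * z.2, s * z.1 + c * z.2)%R) @^-1`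
      (B i `*` B j) by [].
  apply: preimage_measurable; last exact: measurableX.
  apply: measurable_fun_pair.
    by apply: measurable_funB; apply: measurable_funM.
  by apply: measurable_funD; apply: measurable_funM.
have -> : \bigcap_(l in [set: J]) (rotate i j c s g l @^-1` B l) = W @^-1` C `&` E.
  apply/seteqP; split=> t /=.
    move=> H; split; first split.
    - by have := H i Logic.I; rewrite /= /rotate eqxx.
    - by have := H j Logic.I; rewrite /= /rotate (negbTE ji) eqxx.
    - move=> l _; have := H l Logic.I; rewrite /= /rotate.
      by do 2 case: eqP => //= _.
  move=> [[t1 t2] Et] l _; rewrite /= /rotate; have [->//|li] := eqVneq l i.
  have [->//|lj] := eqVneq l j.
  by have := Et l Logic.I; rewrite (negbTE li) (negbTE lj).
pose G : set (set (R * R)) := [set A `*` B | A in measurable & B in measurable].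
rewrite (indep_event_ext P W E G)//.
- by rewrite PE split2 (normal_pair_rotation P _ _ c s (B i) (B j) pr).
- exact: measurable_prod_measurableType.
- move=> _ _ [X1 mX1 [X2 mX2 <-]] [Y1 mY1 [Y2 mY2 <-]]; rewrite -setXI.
  by exists (X1 `&` Y1); [exact: measurableI|exists (X2 `&` Y2) => //; exact: measurableI].
- by exists setT => //; exists setT => //; rewrite setXTT.
- by move=> _ [X1 mX1 [X2 mX2 <-]]; rewrite PWE// PE PW.
Qed.

Definition negate (i : J) (g : J -> T -> R) (l : J) (t : T) : R :=
  if l == i then (- g l t)%R else g l t.

Lemma normal_family_negate i g : normal_family g -> normal_family (negate i g).
Proof.
move=> [mg Pg]; split=> [l|B mB].
  by rewrite /negate; case: eqP => // _; exact: measurableT_comp.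
pose B' l := if l == i then -%R @^-1` B l else B l.
have mN : measurable_fun setT (-%R : R -> R) by [].
have := Pg B'.
have -> : \bigcap_(j in [set: J]) (g j @^-1` B' j) =
    \bigcap_(j in [set: J]) (negate i g j @^-1` B j).
  by apply: eq_bigcapr => j _; rewrite /B' /negate; case: eqP.
move=> ->; last by move=> j; rewrite /B'; case: ifP => // _; exact: preimage_measurable.
by apply: eq_bigr => j _; rewrite /B'; case: ifP => // _; exact: normal_probN.
Qed.

(** Successive Givens rotations carry the weights [w] to the single coordinate [i]. The identities
    hold at every sample point, for a new family that is again normal. *)
Lemma normal_family_align (i : J) (g : J -> T -> R) (w : J -> R) : normal_family g ->
  exists2 g', normal_family g' & forall t,
    (\sum_j w j * g j t = Num.sqrt (\sum_j w j ^+ 2) * g' i t)%R /\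
    (\sum_j g j t ^+ 2 = \sum_j g' j t ^+ 2)%R.
Proof.
(* [r] lists the coordinates other than [i] whose weight may still be nonzero. *)
suff H : forall (r : seq J) (w : J -> R) g, normal_family g ->
    (forall j, j \notin i :: r -> w j = 0%R) ->
    exists2 g', normal_family g' & forall t,
    (\sum_j w j * g j t = Num.sqrt (\sum_j w j ^+ 2) * g' i t)%R /\
    (\sum_j g j t ^+ 2 = \sum_j g' j t ^+ 2)%R.
  by move=> ng; apply: (H (enum J)) => // j; rewrite in_cons mem_enum orbT.
elim => [|j r IH] {}w {}g ng w0.
  have sum1 (F : J -> R) : (forall j, j != i -> F j = 0%R) -> (\sum_j F j = F i)%R.
    by move=> F0; rewrite (bigD1 i)//= big1 ?addr0.
  have w0' j : j != i -> w j = 0%R by move=> ji; apply: w0; rewrite inE.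
  have e1 : (\sum_j w j ^+ 2 = w i ^+ 2)%R.
    by rewrite (sum1 (fun j => w j ^+ 2)%R)// => j ji; rewrite w0'// expr0n.
  have e2 t : (\sum_j w j * g j t = w i * g i t)%R.
    by rewrite (sum1 (fun j => w j * g j t)%R)// => j ji; rewrite w0'// mul0r.
  (* A negative weight is absorbed by flipping the sign of the coordinate [i]. *)
  have [wi|wi] := leP 0%R (w i).
    by exists g => // t; split => //; rewrite e1 e2 sqrtr_sqr ger0_norm.
  exists (negate i g); first exact: normal_family_negate.
  move=> t; split.
    by rewrite e1 e2 sqrtr_sqr ltr0_norm// /negate eqxx mulrNN.
  by apply: eq_bigr => j _; rewrite /negate; case: eqP => // _; rewrite sqrrN.
have [wj0|wj] := eqVneq (w j) 0%R.
  apply: IH => // l; rewrite in_cons negb_or => /andP[li lr].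
  have [->//|lj] := eqVneq l j.
  by apply: w0; rewrite !in_cons (negbTE li) (negbTE lj).
have [ji|ji] := eqVneq j i.
  apply: IH => // l; rewrite in_cons negb_or => /andP[li lr].
  by apply: w0; rewrite !in_cons ji (negbTE li).
pose n := Num.sqrt (w i ^+ 2 + w j ^+ 2).
have wj2 : (0 < w j ^+ 2)%R by rewrite lt0r sqr_ge0 expf_neq0.
have n2p : (0 < w i ^+ 2 + w j ^+ 2)%R by rewrite ltr_wpDl// sqr_ge0.
have n0 : (0 < n)%R by rewrite sqrtr_gt0.
have n2 : (n ^+ 2 = w i ^+ 2 + w j ^+ 2)%R by rewrite sqr_sqrtr// ltW.
have nN0 : n != 0%R by rewrite gt_eqF.
(* With this choice n (c g_i - s g_j) = w_i g_i + w_j g_j, so the weight of the pair moves to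
   [i]. *)
pose c := (w i / n)%R; pose s := (- (w j / n))%R.
have cs : (c ^+ 2 + s ^+ 2 = 1)%R.
  rewrite /c /s sqrrN !expr_div_n -mulrDl -n2 divff// expf_neq0//.
have s0 : s != 0%R by rewrite oppr_eq0 mulf_neq0// invr_eq0.
pose g1 := rotate i j c s g.
pose w1 l := if l == i then n else if l == j then 0%R else w l.
have ng1 : normal_family g1 by apply: normal_family_rotate => //; rewrite eq_sym.
have w10 l : l \notin i :: r -> w1 l = 0%R.
  rewrite in_cons negb_or => /andP[li lr]; rewrite /w1 (negbTE li).
  case: eqP => // /eqP lj; apply: w0.
  by rewrite !in_cons (negbTE li) (negbTE lj).
have [g' ng' Hg'] := IH w1 g1 ng1 w10.
have split2 (F : J -> R) :
    (\sum_(l : J) F l = F i + F j + \sum_(l | (l != i) && (l != j)) F l)%R.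
  by rewrite (bigD1 i)//= (bigD1 j)//= addrA.
have rest (F : J -> R) (F' : J -> R) : (F i + F j = F' i + F' j)%R ->
    (forall l, l != i -> l != j -> F l = F' l) -> (\sum_l F l = \sum_l F' l)%R.
  move=> Fij FF'; rewrite !split2 Fij; congr (_ + _)%R.
  by apply: eq_bigr => l /andP[]; exact: FF'.
have g1i t : g1 i t = (c * g i t - s * g j t)%R by rewrite /g1 /rotate eqxx.
have g1j t : g1 j t = (s * g i t + c * g j t)%R.
  by rewrite /g1 /rotate (negbTE ji) eqxx.
have g1l l t : l != i -> l != j -> g1 l t = g l t.
  by move=> /negbTE li /negbTE lj; rewrite /g1 /rotate li lj.
have w1i : w1 i = n by rewrite /w1 eqxx.
have w1j : w1 j = 0%R by rewrite /w1 (negbTE ji) eqxx.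
have w1l l : l != i -> l != j -> w1 l = w l.
  by move=> /negbTE li /negbTE lj; rewrite /w1 li lj.
exists g' => // t; have [e1 e2] := Hg' t; split.
  rewrite (rest (fun l => w l ^+ 2)%R (fun l => w1 l ^+ 2)%R).
  - rewrite -e1; apply: rest => [|l li lj]; last by rewrite g1l// w1l.
    by rewrite w1i w1j g1i /c /s; field.
  - by rewrite w1i w1j n2 expr0n addr0.
  - by move=> l li lj; rewrite w1l.
rewrite -e2; apply: rest => [|l li lj]; last by rewrite g1l.
rewrite g1i g1j -[LHS]mul1r -cs; ring.
Qed.

End NormalFamily.

(* [0 `^ r = 0] for [r <> 0], so a zero row is normalised to zero. *)
Definition inv_norm {R : realType} (q : R) : R := q `^ (- 2^-1).

Lemma measurable_inv_norm {R : realType} : measurable_fun setT (@inv_norm R).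
Proof. exact: measurable_powR. Qed.

Lemma inv_normE {R : realType} (q : R) : 0 <= q -> inv_norm q = (Num.sqrt q)^-1.
Proof.
rewrite le_eqVlt => /predU1P[<-|q0].
  by rewrite /inv_norm sqrtr0 invr0 powR0// oppr_eq0 invr_eq0.
by rewrite /inv_norm powRN powR12_sqrt// ltW.
Qed.

Definition normalize {R : realType} {M} (y : M.-tuple R) : M.-tuple R :=
  [tuple tnth y j * inv_norm (tsq y) | j < M].

Lemma measurable_normalize {R : realType} M : measurable_fun setT (@normalize R M).
Proof.
apply/measurable_fun_tnthP => j.
apply: (eq_measurable_fun (fun y : M.-tuple R => tnth y j * inv_norm (tsq y))).
  by move=> y _ /=; rewrite tnth_mktuple.
apply: measurable_funM; first exact: measurable_tnth_real.
exact: (measurableT_comp measurable_inv_norm (measurable_tsq M)).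
Qed.

Lemma tsq_normalize {R : realType} M (y : M.-tuple R) : tsq (normalize y) <= 1.
Proof.
have -> : tsq (normalize y) = tsq y * inv_norm (tsq y) ^+ 2.
  by rewrite {1 2}/tsq mulr_suml; apply: eq_bigr => j _; rewrite tnth_mktuple exprMn.
rewrite inv_normE ?tsq_ge0// exprVn sqr_sqrtr ?tsq_ge0//.
by have [->|y0] := eqVneq (tsq y) 0; [rewrite mul0r|rewrite divff].
Qed.

(** A function of the unnormalised row, so that the law of that row can be replaced or rotated
    underneath it. *)
Definition ipn {R : realType} {M} (w : 'I_M -> R) (y : M.-tuple R) : R :=
  (\sum_j w j * tnth y j) * inv_norm (tsq y).

Lemma measurable_ipn {R : realType} M (w : 'I_M -> R) : measurable_fun setT (ipn w).
Proof.
apply: measurable_funM.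
  by apply: measurable_sum => j; apply: measurable_funM => //; exact: measurable_tnth_real.
exact: (measurableT_comp measurable_inv_norm (measurable_tsq M)).
Qed.

Lemma ip_normalize {R : realType} {d : measure_display} {T : measurableType d} M
    (Y : T -> M.-tuple R) w t : ip M (normalize \o Y) w t = ipn w (Y t).
Proof.
by rewrite /ip /ipn mulr_suml; apply: eq_bigr => j _; rewrite tnth_mktuple mulrA.
Qed.

Lemma normal_family_isotropic {R : realType} {d : measure_display}
    {T : measurableType d} (P : probability T R) M (g : 'I_M -> T -> R) :
  normal_family P 'I_M g ->
  isotropic P M (normalize \o (fun t => [tuple g j t | j < M])).
Proof.
move=> ng u w uw B mB.
case: M g ng u w uw => [|M] g ng u w uw.
  by congr (P _); apply/seteqP; split=> t /=; rewrite /ip !big_ord0.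
pose tup (g : 'I_M.+1 -> T -> R) t := [tuple g j t | j < M.+1].
have mtup h : normal_family P _ h -> measurable_fun setT (tup h).
  move=> [mh _]; apply/measurable_fun_tnthP => j.
  by apply: (eq_measurable_fun (h j)) => // t _ /=; rewrite tnth_mktuple.
(* Two normal families have the same joint law, since they agree on boxes. *)
have law h h' C : normal_family P _ h -> normal_family P _ h' -> measurable C ->
    P (tup h @^-1` C) = P (tup h' @^-1` C).
  move=> nh nh' mC.
  pose m (h0 : 'I_M.+1 -> T -> R) (mh0 : measurable_fun setT (tup h0)) :
      {mfun T >-> M.+1.-tuple R} :=
    HB.pack (tup h0) (isMeasurableFun.Build _ _ _ _ _ mh0).
  rewrite -[LHS]/(distribution P (m h (mtup h nh)) C).
  rewrite -[RHS]/(distribution P (m h' (mtup h' nh')) C).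
  apply: (measure_unique (rects M.+1) (fun=> setT)) => //.
  - exact: measurable_rects.
  - exact: setI_closed_rects.
  - by move=> _; exact: rectsT.
  - by rewrite bigcup_const.
  - move=> _ [D mD ->].
    have rectE h0 : tup h0 @^-1` rect M.+1 D =
        \bigcap_(j in [set: 'I_M.+1]) (h0 j @^-1` D j).
      apply/seteqP; split=> t /= H j; first by have := H j; rewrite tnth_mktuple.
      by rewrite tnth_mktuple; exact: H.
    rewrite -[LHS]/(P (tup h @^-1` rect M.+1 D)) -[RHS]/(P (tup h' @^-1` rect M.+1 D)).
    by rewrite !rectE (proj2 nh)// (proj2 nh').
  - by move=> _; rewrite (le_lt_trans (probability_le1 _ _))// ltry.
pose b := Num.sqrt (\sum_j w j ^+ 2).
(* The right-hand side depends on [v] through its length only, so [u] and [w] share it. *)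
suff H v : \sum_j v j ^+ 2 = \sum_j w j ^+ 2 ->
    P (ip M.+1 (normalize \o tup g) v @^-1` B) =
    P (tup g @^-1` (ipn (fun j => if j == ord0 then b else 0) @^-1` B)).
  by rewrite (H u uw) (H w).
move=> vw; have [h nh Hh] := normal_family_align P _ ord0 g v ng.
rewrite -(law h)//; last by apply: preimage_measurable => //; exact: measurable_ipn.
suff E t : ip M.+1 (normalize \o tup g) v t =
    ipn (fun j => if j == ord0 then b else 0) (tup h t).
  by congr (P _); apply/seteqP; split=> t /=; rewrite E.
rewrite ip_normalize /ipn; have [e1 e2] := Hh t; congr (_ * inv_norm _).
  transitivity (\sum_j v j * g j t).
    by apply: eq_bigr => j _; rewrite tnth_mktuple.
  rewrite e1 vw -/b (bigD1 ord0)//= tnth_mktuple big1 ?addr0//.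
  by move=> j /negbTE ->; rewrite mul0r.
transitivity (\sum_j g j t ^+ 2).
  by apply: eq_bigr => j _; rewrite tnth_mktuple.
by rewrite e2; apply: eq_bigr => j _; rewrite tnth_mktuple.
Qed.

(** * Rotation invariance of the spherical models *)

Section Householder.
(** With [conj] the identity or complex conjugation, one construction serves the orthogonal and the
    unitary case. *)
Variables (F : fieldType) (conj : {rmorphism F -> F}) (L : nat).
Hypothesis conjK : involutive conj.
Local Notation "M ^*t" := (map_mx conj M)^T (at level 8).
Hypothesis definite : forall z : 'cV[F]_L, z^*t *m z = 0 -> z = 0.

(* The generalised Householder map [1 - z z^* / (z^* w)] with [z = w - u] is
   unitary and sends [w] to [u], even when [u^* w] is not real. *)
Lemma householder (u w : 'cV[F]_L) : u^*t *m u = w^*t *m w ->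
  exists2 U : 'M[F]_L, U *m U^*t = 1%:M & U *m w = u.
Proof.
move=> uw; pose z := w - u; pose b := (z^*t *m w) 0 0.
have ctM m n p (A : 'M[F]_(m, n)) (B : 'M[F]_(n, p)) : (A *m B)^*t = B^*t *m A^*t.
  by rewrite map_mxM trmx_mul.
have ctK m n (A : 'M[F]_(m, n)) : A^*t^*t = A.
  by apply/matrixP => i j; rewrite !mxE conjK.
have ctB m n (A B : 'M[F]_(m, n)) : (A - B)^*t = A^*t - B^*t.
  by rewrite map_mxB linearB.
have ctZ m n a (A : 'M[F]_(m, n)) : (a *: A)^*t = conj a *: A^*t.
  by apply/matrixP => i j; rewrite !mxE rmorphM.
have bE : z^*t *m w = b%:M by exact: mx11_scalar.
have bJ : w^*t *m z = (conj b)%:M.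
  rewrite -[w^*t *m z]ctK ctM ctK bE.
  by apply/matrixP => i j; rewrite !mxE rmorphMn eq_sym.
(* The equality of lengths enters here: z^* u = w^* u - u^* u = w^* u - w^* w = - w^* z. *)
have zu : z^*t *m u = - (conj b)%:M.
  by rewrite -bJ /z ctB mulmxBl mulmxBr uw opprB.
have zz : z^*t *m z = (b + conj b)%:M.
  by rewrite {2}/z mulmxBr bE zu opprK raddfD.
have [b0|b0] := eqVneq b 0.
  exists 1%:M; first by rewrite map_mx1 trmx1 mulmx1.
  have /eqP : z = 0 by apply: definite; rewrite zz b0 rmorph0 addr0 raddf0.
  by rewrite subr_eq0 mul1mx => /eqP.
pose Z := z *m z^*t.
have cb0 : conj b != 0 by rewrite fmorph_eq0.
have ZZ : Z *m Z = (b + conj b) *: Z.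
  by rewrite /Z mulmxA -(mulmxA z) zz mul_mx_scalar -scalemxAl.
have Zt : Z^*t = Z by rewrite /Z ctM ctK.
exists (1%:M - b^-1 *: Z).
  (* As Z Z = (b + conj b) Z, unitarity reduces to 1 / b + 1 / conj b = (b + conj b) / (b conj
     b). *)
  rewrite ctB ctZ Zt map_mx1 trmx1 fmorphV.
  rewrite mulmxBl !mulmxBr !mul1mx mulmx1 -scalemxAl -scalemxAr ZZ !scalerA.
  rewrite -addrA -opprD -[RHS]subr0; congr (_ - _).
  rewrite addrA -scalerDl -scalerBl (_ : _ - _ = 0) ?scale0r//.
  by field; rewrite cb0.
rewrite mulmxBl mul1mx -scalemxAl /Z -mulmxA bE mul_mx_scalar scalerA mulVf//.
by rewrite scale1r /z opprB addrC subrK.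
Qed.

End Householder.

Lemma householder_real {R : realType} L (u w : 'cV[R]_L) :
  \sum_j u j 0 ^+ 2 = \sum_j w j 0 ^+ 2 ->
  exists2 Q : 'M[R]_L, Q *m Q^T = 1%:M & Q *m w = u.
Proof.
have sqE (z : 'cV[R]_L) : (map_mx idfun z)^T *m z = (\sum_j z j 0 ^+ 2)%:M.
  rewrite [LHS]mx11_scalar; congr (_%:M); rewrite mxE.
  by apply: eq_bigr => j _; rewrite !mxE.
move=> uw; have [|||Q QQ Qw] := @householder R idfun L _ _ u w.
- by [].
- move=> z; rewrite sqE => /matrixP/(_ 0 0); rewrite !mxE eqxx mulr1n.
  move=> /eqP; rewrite psumr_eq0 => [/allP z0|j _]; last exact: sqr_ge0.
  apply/matrixP => j k; rewrite ord1 mxE; apply/eqP.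
  by have := z0 j (mem_index_enum _); rewrite /= sqrf_eq0.
- by rewrite !sqE uw.
- by exists Q => //; rewrite -QQ map_mx_id.
Qed.

Section ComplexParts.
Context {R : realType}.
Implicit Types z : R[i].

Lemma Re_sum I (r : seq I) (p : pred I) (f : I -> R[i]) :
  complex.Re (\sum_(i <- r | p i) f i) = \sum_(i <- r | p i) complex.Re (f i).
Proof. by apply: (big_morph (@complex.Re R)) => // -[? ?] [? ?]. Qed.

Lemma Im_sum I (r : seq I) (p : pred I) (f : I -> R[i]) :
  complex.Im (\sum_(i <- r | p i) f i) = \sum_(i <- r | p i) complex.Im (f i).
Proof. by apply: (big_morph (@complex.Im R)) => // -[? ?] [? ?]. Qed.

Lemma ReM z1 z2 : complex.Re (z1 * z2) =
  complex.Re z1 * complex.Re z2 - complex.Im z1 * complex.Im z2.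
Proof. by case: z1 z2 => [? ?] [? ?]. Qed.

Lemma ImM z1 z2 : complex.Im (z1 * z2) =
  complex.Re z1 * complex.Im z2 + complex.Im z1 * complex.Re z2.
Proof. by case: z1 z2 => [? ?] [? ?]. Qed.

Lemma cmod_sq z : cmod z ^+ 2 = complex.Re z ^+ 2 + complex.Im z ^+ 2.
Proof. by rewrite sqr_sqrtr// addr_ge0// sqr_ge0. Qed.

Lemma cconjE z : cconj z = conjc z. Proof. by case: z. Qed.

Lemma mul_cconj z : cconj z * z = (cmod z ^+ 2)%:C%C.
Proof.
by rewrite cmod_sq; apply/eqP; rewrite eq_complex ReM ImM /=; apply/andP; split;
  apply/eqP; ring.
Qed.

Lemma adjmxE m n (M : 'M[R[i]]_(m, n)) : adjmx M = (map_mx conjc M)^T.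
Proof. by apply/matrixP => i j; rewrite !mxE cconjE. Qed.

End ComplexParts.

Lemma householder_complex {R : realType} L (u w : 'cV[R[i]]_L) :
  \sum_j cmod (u j 0) ^+ 2 = \sum_j cmod (w j 0) ^+ 2 ->
  exists2 U : 'M[R[i]]_L, U *m adjmx U = 1%:M & U *m w = u.
Proof.
have sqE (z : 'cV[R[i]]_L) :
    (map_mx conjc z)^T *m z = (\sum_j cmod (z j 0) ^+ 2)%:C%C%:M.
  rewrite [LHS]mx11_scalar; congr (_%:M); rewrite mxE rmorph_sum/=.
  by apply: eq_bigr => j _; rewrite !mxE -cconjE mul_cconj.
move=> uw; have [|||U UU Uw] := @householder R[i] conjc L _ _ u w.
- exact: conjcK.
- move=> z; rewrite sqE => /matrixP/(_ 0 0); rewrite !mxE eqxx mulr1n => -[].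
  move=> /eqP; rewrite psumr_eq0 => [/allP z0|j _]; last exact: sqr_ge0.
  apply/matrixP => j k; rewrite ord1 mxE; apply/eqP.
  have := z0 j (mem_index_enum _); rewrite /= cmod_sq paddr_eq0 ?sqr_ge0//.
  by rewrite !sqrf_eq0 eq_complex.
- by rewrite !sqE uw.
- by exists U => //; rewrite -UU adjmxE.
Qed.

(** If Q w = u, then Y Q w = Y u, and Y Q has the length and the law of Y. *)
Lemma spherical_isotropic_real {R : realType} {d : measure_display}
    {T : measurableType d} (P : probability T R) L (Y : T -> 'rV[R]_L) :
  uniform_sphere_R P Y -> isotropic P L (normalize \o (fun t => rrow (Y t) ord0)).
Proof.
move=> [_ inv] u w uw B mB.
have [|Q QQ Qw] := @householder_real R L (\col_j u j) (\col_j w j).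
  by under eq_bigr do rewrite mxE; under [RHS]eq_bigr do rewrite mxE.
pose K v := ipn v @^-1` B : set (L.-tuple R).
have KE v : ip L (normalize \o (fun t => rrow (Y t) ord0)) v @^-1` B =
    (fun t => rrow (Y t) ord0) @^-1` K v.
  by apply/seteqP; split=> t /=; rewrite ip_normalize.
rewrite !KE (inv Q QQ (K w)); last by apply: preimage_measurable => //; exact: measurable_ipn.
congr (P _).
suff E t : ipn w (rrow (Y t *m Q) ord0) = ipn u (rrow (Y t) ord0).
  by apply/seteqP; split=> t; rewrite /K /= E.
rewrite /ipn; congr (_ * inv_norm _).
  have -> : \sum_j w j * tnth (rrow (Y t *m Q) ord0) j =
      (Y t *m Q *m \col_j w j) 0 0.
    rewrite mxE; apply: eq_bigr => j _; rewrite tnth_mktuple [RHS]mulrC.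
    by congr (_ * _); rewrite mxE.
  rewrite -mulmxA Qw mxE; apply: eq_bigr => j _.
  by rewrite tnth_mktuple mxE mulrC.
have sqE (y : 'rV[R]_L) : tsq (rrow y ord0) = (y *m y^T) 0 0.
  by rewrite mxE; apply: eq_bigr => j _; rewrite tnth_mktuple mxE.
by rewrite !sqE trmx_mul mulmxA -(mulmxA (Y t)) QQ mulmx1.
Qed.

Definition cflat {R : realType} {L} (y : L.-tuple (R * R)) : (L + L).-tuple R :=
  [tuple match fintype.split c with inl j => (tnth y j).1 | inr j => (tnth y j).2 end
    | c < L + L].

Lemma measurable_cflat {R : realType} L : measurable_fun setT (@cflat R L).
Proof.
apply/measurable_fun_tnthP => c.
apply: (eq_measurable_fun (fun y : L.-tuple (R * R) =>
  match fintype.split c with inl j => (tnth y j).1 | inr j => (tnth y j).2 end)).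
  by move=> y _ /=; rewrite tnth_mktuple.
case: (fintype.split c) => j.
  exact: (measurableT_comp measurable_fst (measurable_tnth j)).
exact: (measurableT_comp measurable_snd (measurable_tnth j)).
Qed.

Lemma sum_cflat {R : realType} L (y : L.-tuple (R * R)) (F : 'I_(L + L) -> R -> R) :
  \sum_c F c (tnth (cflat y) c) =
  \sum_(j < L) F (lshift L j) (tnth y j).1 + \sum_(j < L) F (rshift L j) (tnth y j).2.
Proof.
rewrite big_split_ord/=; congr (_ + _); apply: eq_bigr => j _; rewrite tnth_mktuple.
  by rewrite (unsplitK (inl j)).
by rewrite (unsplitK (inr j)).
Qed.

Lemma spherical_isotropic_complex {R : realType} {d : measure_display}
    {T : measurableType d} (P : probability T R) L (Y : T -> 'rV[R[i]]_L) :
  uniform_sphere_C P Y ->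
  isotropic P (L + L) (normalize \o (fun t => cflat (crow (Y t) ord0))).
Proof.
move=> [_ inv] u w uw B mB.
(* The product [y *m cv v] conjugates nothing, so the sign of the imaginary part makes its real part
   the inner product of R^(2 L). *)
pose cv (v : 'I_(L + L) -> R) : 'cV[R[i]]_L :=
  \col_j Complex (v (lshift L j)) (- v (rshift L j)).
have cvE v : \sum_j cmod (cv v j 0) ^+ 2 = \sum_c v c ^+ 2.
  rewrite [RHS]big_split_ord/= -big_split/=; apply: eq_bigr => j _.
  by rewrite cmod_sq mxE /= sqrrN.
have [|U UU Uw] := @householder_complex R L (cv u) (cv w); first by rewrite !cvE.
pose K v : set (L.-tuple (R * R)) := (ipn v \o @cflat R L) @^-1` B.
have KE v : ip (L + L) (normalize \o (fun t => cflat (crow (Y t) ord0))) v @^-1` B =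
    (fun t => crow (Y t) ord0) @^-1` K v.
  apply/seteqP; split=> t /=.
    by rewrite (ip_normalize _ (fun t => cflat (crow (Y t) ord0))).
  by rewrite (ip_normalize _ (fun t => cflat (crow (Y t) ord0))).
rewrite !KE (inv U UU (K w)); last first.
  apply: preimage_measurable => //; apply: measurableT_comp; last exact: measurable_cflat.
  exact: measurable_ipn.
congr (P _).
suff E t : ipn w (cflat (crow (Y t *m U) ord0)) = ipn u (cflat (crow (Y t) ord0)).
  by apply/seteqP; split=> t; rewrite /K /= E.
have dotE v (y : 'rV[R[i]]_L) :
    \sum_c v c * tnth (cflat (crow y ord0)) c = complex.Re ((y *m cv v) 0 0).
  rewrite (sum_cflat _ _ (fun c r => v c * r)) mxE Re_sum -big_split/=.
  by apply: eq_bigr => j _; rewrite tnth_mktuple mxE ReM /=; ring.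
have sqE (y : 'rV[R[i]]_L) :
    tsq (cflat (crow y ord0)) = complex.Re ((y *m adjmx y) 0 0).
  rewrite /tsq (sum_cflat _ _ (fun c r => r ^+ 2)) mxE Re_sum -big_split/=.
  by apply: eq_bigr => j _; rewrite tnth_mktuple mxE ReM /=; ring.
rewrite /ipn !dotE !sqE -mulmxA Uw; congr (_ * inv_norm (complex.Re _)).
have adjM (y : 'rV[R[i]]_L) : adjmx (y *m U) = adjmx U *m adjmx y.
  by rewrite !adjmxE map_mxM trmx_mul.
by rewrite adjM mulmxA -(mulmxA (Y t)) UU mulmx1.
Qed.

(** * Deterministic recovery *)

Lemma cauchy_schwarz {R : realType} (I : finType) (x y : I -> R) :
  \sum_j x j * y j <= Num.sqrt (\sum_j x j ^+ 2) * Num.sqrt (\sum_j y j ^+ 2).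
Proof.
have sq0 (z : I -> R) : 0 <= \sum_j z j ^+ 2.
  by apply: sumr_ge0 => j _; exact: sqr_ge0.
set p := Num.sqrt _; set q := Num.sqrt _.
have p2 : p ^+ 2 = \sum_j x j ^+ 2 by rewrite sqr_sqrtr.
have q2 : q ^+ 2 = \sum_j y j ^+ 2 by rewrite sqr_sqrtr.
have zero (z : I -> R) : \sum_j z j ^+ 2 = 0 -> forall j, z j = 0.
  move=> /eqP; rewrite psumr_eq0 => [/allP z0 j|j _]; last exact: sqr_ge0.
  by have := z0 j (mem_index_enum _); rewrite /= sqrf_eq0 => /eqP.
have [p0|p0] := eqVneq p 0.
  rewrite big1 ?p0 ?mul0r// => j _; rewrite (zero x) ?mul0r//.
  by rewrite -p2 p0 expr0n.
have [q0|q0] := eqVneq q 0.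
  rewrite big1 ?q0 ?mulr0// => j _; rewrite (zero y) ?mulr0//.
  by rewrite -q2 q0 expr0n.
have pq : 0 < p * q by rewrite mulr_gt0// lt0r ?p0 ?q0 sqrtr_ge0.
have : 0 <= \sum_j (q * x j - p * y j) ^+ 2 by exact: (sq0 (fun j => q * x j - p * y j)).
have -> : \sum_j (q * x j - p * y j) ^+ 2 =
    2 * (p * q) * (p * q) - 2 * (p * q) * \sum_j x j * y j.
  transitivity (q ^+ 2 * (\sum_j x j ^+ 2) + p ^+ 2 * (\sum_j y j ^+ 2)
      - 2 * (p * q) * \sum_j x j * y j).
    rewrite !mulr_sumr -sumrN -!big_split/=; apply: eq_bigr => j _; ring.
  by rewrite -p2 -q2; ring.
by rewrite subr_ge0 ler_pM2l// mulr_gt0.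
Qed.

Section Recovery.
Context {R : realType}.
Local Notation C := R[i].

Definition rownorm L (y : 'I_L -> C) : R := Num.sqrt (\sum_c cmod (y c) ^+ 2).

(** The inner product of C^L regarded as R^(2 L), the one that governs subgradients of the row
    norm. *)
Definition redot L (a b : 'I_L -> C) : R := \sum_c complex.Re (cconj (a c) * b c).

Lemma rownorm_ge0 L (y : 'I_L -> C) : 0 <= rownorm L y. Proof. exact: sqrtr_ge0. Qed.

Lemma redot_le L (a b : 'I_L -> C) : redot L a b <= rownorm L a * rownorm L b.
Proof.
pose f (z : 'I_L -> C) (x : 'I_L * bool) : R :=
  if x.2 then complex.Re (z x.1) else complex.Im (z x.1).
have sumf (F : 'I_L * bool -> R) : \sum_x F x = \sum_c (F (c, true) + F (c, false)).
  rewrite (eq_bigr (fun x => F (x.1, x.2))); last by case.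
  rewrite -(pair_bigA _ (fun c b => F (c, b)))/=.
  by apply: eq_bigr => c _; rewrite big_bool.
have fE z : \sum_x f z x ^+ 2 = \sum_c cmod (z c) ^+ 2.
  by rewrite sumf; apply: eq_bigr => c _; rewrite cmod_sq.
have := cauchy_schwarz _ (f a) (f b).
rewrite !fE sumf; apply: le_trans; rewrite le_eqVlt; apply/orP; left; apply/eqP.
by apply: eq_bigr => c _; rewrite ReM /=; ring.
Qed.

Lemma rownorm_eq0 L (y : 'I_L -> C) : rownorm L y = 0 -> forall c, y c = 0.
Proof.
move=> /eqP; rewrite sqrtr_eq0 => y0 c.
have : \sum_c cmod (y c) ^+ 2 == 0.
  by rewrite eq_le y0 sumr_ge0// => j _; exact: sqr_ge0.
rewrite psumr_eq0 => [/allP/(_ c (mem_index_enum _))|j _]; last exact: sqr_ge0.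
by rewrite /= cmod_sq paddr_eq0 ?sqr_ge0// !sqrf_eq0 => cy; apply/eqP; rewrite eq_complex.
Qed.

(** If u B^* B = 0, then |u B^*|^2 = 0, and the rows of B^* are independent. *)
Lemma gram_unit n k (B : 'M[C]_(n, k)) : \rank B = k -> adjmx B *m B \in unitmx.
Proof.
move=> rB; rewrite -row_free_unit -kermx_eq0; apply/rowV0P => u /sub_kermxP uG.
have free : row_free (adjmx B) by rewrite /row_free adjmxE mxrank_tr mxrank_map rB.
apply: (row_free_inj free); rewrite /= mul0mx; apply/matrixP => r c.
rewrite ord1 [RHS]mxE; pose z := u *m adjmx B; rewrite -/z.
have : (z *m adjmx z) 0 0 = 0.
  have -> : adjmx z = B *m adjmx u.
    rewrite /z !adjmxE map_mxM trmx_mul; congr (_ *m _).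
    by apply/matrixP => i j; rewrite !mxE; exact: conjcK.
  by rewrite /z mulmxA -(mulmxA u) uG mul0mx mxE.
rewrite mxE (eq_bigr (fun j => (cmod (z 0 j) ^+ 2)%:C%C)); last first.
  by move=> j _; rewrite -mul_cconj mulrC mxE.
rewrite -rmorph_sum/= => -[] /eqP.
rewrite psumr_eq0 => [/allP/(_ c (mem_index_enum _))|j _]; last exact: sqr_ge0.
by rewrite /= cmod_sq paddr_eq0 ?sqr_ge0// !sqrf_eq0 => cy; apply/eqP; rewrite eq_complex.
Qed.

(* [sg] plays the role of the row-normalised [X^S]; zero rows are allowed. *)
Lemma recovery_condition n N L (A : 'M[C]_(n, N)) (S : {set 'I_N})
    (X : 'M[C]_(N, L)) (sg : 'I_#|S| -> 'I_L -> C) :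
  \rank (colS A S) = #|S| ->
  (forall j c, j \notin S -> X j c = 0) ->
  (forall i, rownorm L (sg i) <= 1) ->
  (forall i, redot L (sg i) (X (enum_val i)) = rownorm L (X (enum_val i))) ->
  (forall l, l \notin S -> rownorm L (fun c =>
     \sum_i cconj ((pinvS A S *m col l A) i 0) * sg i c) < 1) ->
  unique_l21_min A X.
Proof.
move=> rA XS sg1 sgX sgl Z AZ ZX.
pose H := Z - X; pose v l i := (pinvS A S *m col l A) i 0.
have AH : A *m H = 0 by rewrite mulmxBr AZ subrr.
(* Applying [pinvS] to A H = 0 expresses the rows of [H] in [S] through the rows outside. *)
have HS i c : H (enum_val i) c = - \sum_(l | l \notin S) v l i * H l c.
  pose HSm : 'M[C]_(#|S|, L) := \matrix_(i, c) H (enum_val i) c.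
  have AHE : A *m H = colS A S *m HSm + \sum_(l | l \notin S) col l A *m row l H.
    apply/matrixP => r c'; rewrite [LHS]mxE [RHS]mxE summxE [LHS](bigID (mem S))/=.
    rewrite big_enum_val; congr (_ + _).
      by rewrite [RHS]mxE; apply: eq_bigr => i' _; rewrite !mxE.
    by apply: eq_bigr => l _; rewrite [RHS]mxE big_ord1 !mxE.
  have e : colS A S *m HSm = - \sum_(l | l \notin S) col l A *m row l H.
    by apply/eqP; rewrite -addr_eq0 -AHE AH.
  have := congr1 (mulmx (pinvS A S)) e.
  rewrite mulmxA /pinvS -(mulmxA _ (adjmx _)) mulVmx ?gram_unit// mul1mx.
  rewrite mulmxN mulmx_sumr => /matrixP/(_ i c); rewrite !mxE => ->; congr (- _).
  rewrite summxE; apply: eq_bigr => l _.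
  by rewrite mulmxA mxE big_ord1 [row l H _ _]mxE.
pose g l c := \sum_i cconj (v l i) * sg i c.
have HX j : j \notin S -> forall c, Z j c = H j c.
  by move=> jS c; rewrite /H !mxE XS// subr0.
(* [g l] is a_l^* W for the dual certificate W = A_S (A_S^* A_S)^-1 sg. *)
have sumrip : \sum_i redot L (sg i) (H (enum_val i)) =
    - \sum_(l | l \notin S) redot L (g l) (H l).
  rewrite /redot exchange_big/= [in RHS]exchange_big/= -sumrN; apply: eq_bigr => c _.
  rewrite -!Re_sum.
  have -> : \sum_(l | l \notin S) cconj (g l c) * H l c =
      \sum_i cconj (sg i c) * \sum_(l | l \notin S) v l i * H l c.
    under [RHS]eq_bigr do rewrite mulr_sumr.
    rewrite exchange_big/=; apply: eq_bigr => l _.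
    rewrite cconjE /g rmorph_sum/= mulr_suml; apply: eq_bigr => i _.
    have cK : conjc (cconj (v l i)) = v l i by rewrite cconjE conjcK.
    rewrite rmorphM -[X in X * _ * _]/(conjc (cconj (v l i))) cK.
    by rewrite -[X in _ * X * _]/(conjc (sg i c)) -cconjE; ring.
  under eq_bigr do rewrite HS mulrN.
  have ReN (z : C) : complex.Re (- z) = - complex.Re z by case: z.
  by rewrite sumrN ReN.
have norm21E (W : 'M[C]_(N, L)) : norm21 W =
    \sum_(i < #|S|) rownorm L (W (enum_val i)) + \sum_(l | l \notin S) rownorm L (W l).
  by rewrite /norm21 (bigID (mem S))/= big_enum_val.
have outX : \sum_(l | l \notin S) rownorm L (X l) = 0.
  apply: big1 => l lS; rewrite /rownorm big1 ?sqrtr0// => c _.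
  by rewrite XS// cmod_sq /= expr0n addr0.
have outZ : \sum_(l | l \notin S) rownorm L (Z l) = \sum_(l | l \notin S) rownorm L (H l).
  apply: eq_bigr => l lS; rewrite /rownorm; congr Num.sqrt.
  by apply: eq_bigr => c _; rewrite HX.
(* The subgradient inequality: |X^i| + <sg_i, H^i> = <sg_i, Z^i> <= |Z^i|. *)
have inZ : \sum_(i < #|S|) rownorm L (X (enum_val i)) + \sum_i redot L (sg i) (H (enum_val i)) <=
    \sum_(i < #|S|) rownorm L (Z (enum_val i)).
  rewrite -big_split/=; apply: ler_sum => i _.
  apply: (@le_trans _ _ (rownorm L (sg i) * rownorm L (Z (enum_val i)))); last first.
    by rewrite ler_piMl// rownorm_ge0.
  apply: le_trans (redot_le _ _ _); rewrite -sgX /redot -big_split/=.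
  apply: ler_sum => c _; rewrite !ReM /H !mxE /=.
  by case: (Z _ c) (X _ c) => [? ?] [? ?] /=; lra.
have gH l : l \notin S -> redot L (g l) (H l) <= rownorm L (H l).
  move=> lS; apply: le_trans (redot_le _ _ _) _.
  by rewrite ler_piMl ?rownorm_ge0// ltW// sgl.
(* If [H] vanished outside [S], [HS] would make it zero; this row provides the strict inequality. *)
have [l lS Hl] : exists2 l, l \notin S & rownorm L (H l) != 0.
  apply: contrapT => noH; apply: ZX; apply/matrixP => j c.
  have Hout l : l \notin S -> forall c', H l c' = 0.
    move=> lS; apply: rownorm_eq0; apply/eqP/negPn/negP => Hl.
    by apply: noH; exists l.
  apply/eqP; rewrite -subr_eq0; apply/eqP.
  have <- : H j c = Z j c - X j c by rewrite /H !mxE.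
  have [jS|jS] := boolP (j \in S); last exact: Hout.
  rewrite -(enum_rankK_in jS jS) HS big1 ?oppr0// => l lS.
  by rewrite Hout// mulr0.
have strict : \sum_(l | l \notin S) redot L (g l) (H l) <
    \sum_(l | l \notin S) rownorm L (H l).
  rewrite (bigD1 l)//= [ltRHS](bigD1 l)//=; apply: ltr_leD.
    apply: le_lt_trans (redot_le _ _ _) _.
    by rewrite gtr_pMl ?sgl// lt0r Hl rownorm_ge0.
  by apply: ler_sum => l' /andP[l'S _]; exact: gH.
rewrite !norm21E outX outZ addr0.
move: inZ strict; rewrite sumrip; lra.
Qed.

End Recovery.

(** * From isotropic rows to a probability bound *)

Lemma union_bound {R : realType} {d : measure_display} {T : measurableType d}
    (P : probability T R) N (bad : 'I_N -> set T) (e : R) (E : set T) :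
  (forall l, measurable (bad l)) -> (forall l, (P (bad l) <= e%:E)%E) ->
  (forall t, (forall l, ~ bad l t) -> E t) ->
  prob_at_least P E (1 - N%:R * e).
Proof.
move=> mbad Pbad HE; pose U := \big[setU/set0]_(l < N) bad l.
have mU : measurable U by exact: bigsetU_measurable.
have PU : (P U <= (N%:R * e)%:E)%E.
  rewrite /U; have -> : (N%:R * e)%:E = (\sum_(l < N) e%:E)%E.
    by rewrite sumEFin sumr_const card_ord mulr_natl.
  elim: (index_enum _) => [|l r IH]; first by rewrite !big_nil measure0.
  rewrite !big_cons; apply: le_trans (leeD (Pbad l) IH).
  by apply: measureU2 => //; exact: bigsetU_measurable.
exists (~` U); split; first exact: measurableC.
split=> [t nU|].
  by apply: HE => l bt; apply: nU; rewrite /U (bigD1 l)//=; left.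
by rewrite probability_setC// EFinB; apply: leeB.
Qed.

(** [psi i] plays the adjoint of [phi i]: it turns <x, phi_i s> into a functional of s, whose
    exponential moment isotropy controls. The two norm bounds give the same rho_i. *)
Lemma isotropic_sum_tail {R : realType} {d : measure_display} {T : measurableType d}
    (P : probability T R) k M n (Y : 'I_k -> T -> M.-tuple R)
    (phi : 'I_k -> M.-tuple R -> n.-tuple R) (psi : 'I_k -> n.-tuple R -> 'I_M -> R)
    (rho : 'I_k -> R) (alpha : R) :
  0 < alpha -> alpha < 1 -> mutually_independent P Y ->
  (forall i, isotropic P M (normalize \o Y i)) ->
  (forall i, measurable_fun setT (phi i)) -> (forall i, 0 <= rho i) ->
  (forall i y, tsq (phi i y) <= rho i * tsq y) ->
  (forall i x y, \sum_c tnth x c * tnth (phi i y) c = \sum_j psi i x j * tnth y j) ->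
  (forall i x, \sum_j psi i x j ^+ 2 <= rho i * tsq x) ->
  \sum_i rho i <= alpha ^+ 2 ->
  (P [set t | (1 <= \sum_(c < n) (\sum_(i < k) tnth (phi i (normalize (Y i t))) c) ^+ 2)%R]
    <= (expR (- (M%:R / 2) * (alpha ^- 2 - ln (alpha ^- 2) - 1)))%:E)%E.
Proof.
move=> a0 a1 indY isoY mphi rho0 phirho adj psirho rhoa.
pose U i := phi i \o @normalize R M \o Y i.
have mphin i : measurable_fun setT (phi i \o @normalize R M).
  by apply: measurableT_comp => //; exact: measurable_normalize.
have indU : mutually_independent P U.
  exact: (mutually_independent_comp P _ Y (fun i => phi i \o @normalize R M)).
(* In dimension 0 every summand vanishes and the event is empty. *)
have [M0|M0] := posnP M.
  subst M; rewrite (_ : [set t | _] = set0) ?measure0 ?lee_fin ?expR_ge0//.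
  apply/seteqP; split => // t /=; rewrite big1 ?ler10// => c _.
  rewrite big1 ?expr0n// => i _; set z := phi i _; apply/eqP; rewrite -sqrf_eq0.
  rewrite eq_le sqr_ge0 andbT; apply: (@le_trans _ _ (tsq z)).
    by rewrite /tsq (bigD1 c)//= lerDl sumr_ge0// => c' _; exact: sqr_ge0.
  by apply: le_trans (phirho i _) _; rewrite /tsq big_ord0 mulr0.
apply: (subgaussian_sum_tail P n k U M%:R alpha rho) => //.
- by rewrite ltr0n.
- move=> i t; apply: le_trans (phirho i _) _.
  by rewrite ler_piMr//; exact: tsq_normalize.
- move=> i x.
  have mY : measurable_fun setT (Y i) by case: indY.
  have mnY : measurable_fun setT (normalize \o Y i).
    by apply: measurableT_comp => //; exact: measurable_normalize.
  have := isotropic_subgaussian P M (normalize \o Y i) M0 mnY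
    (fun t => tsq_normalize M _) (isoY i) (psi i x).
  rewrite (eq_integral (fun t => (expR (\sum_c tnth x c * tnth (U i t) c)%R)%:E)).
    move/le_trans; apply; rewrite lee_fin ler_expR; exact: ler_wpM2r.
  by move=> t _; rewrite adj.
Qed.

(** * Random recovery *)

Section RandomRecovery.
Context {R : realType} (L : nat).
Local Notation C := R[i].

(** Here [s] decodes a real tuple into a complex row, and the result lists v s(y) in R^(2 L). *)
Definition scaled_parts {M} (s : M.-tuple R -> 'I_L -> C) (v : C) (y : M.-tuple R) :
    (L + L).-tuple R :=
  [tuple match fintype.split c with
         | inl j => complex.Re (v * s y j)
         | inr j => complex.Im (v * s y j) end | c < L + L].

Lemma tnth_scaled_parts_l M (s : M.-tuple R -> 'I_L -> C) v y j :
  tnth (scaled_parts s v y) (lshift L j) = complex.Re (v * s y j).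
Proof. by rewrite tnth_mktuple (unsplitK (inl j)). Qed.

Lemma tnth_scaled_parts_r M (s : M.-tuple R -> 'I_L -> C) v y j :
  tnth (scaled_parts s v y) (rshift L j) = complex.Im (v * s y j).
Proof. by rewrite tnth_mktuple (unsplitK (inr j)). Qed.

(** The common form of the four models: [M = L] with a real decoding [s], or [M = L + L] with tuples
    of real and imaginary parts. *)
Lemma random_recovery {d : measure_display} {T : measurableType d}
    (P : probability T R) n N M (A : 'M[C]_(n, N)) (S : {set 'I_N}) (alpha : R)
    (Y : 'I_#|S| -> T -> M.-tuple R) (s : M.-tuple R -> 'I_L -> C)
    (psi : C -> (L + L).-tuple R -> 'I_M -> R) (sigma : 'I_#|S| -> R)
    (X : T -> 'M[C]_(N, L)) :
  \rank (colS A S) = #|S| -> 0 < alpha -> alpha < 1 ->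
  (forall l : 'I_N, l \notin S -> vnorm2 (pinvS A S *m col l A) <= alpha) ->
  mutually_independent P Y -> (forall i, isotropic P M (normalize \o Y i)) ->
  (forall j, measurable_fun setT (fun y => complex.Re (s y j))) ->
  (forall j, measurable_fun setT (fun y => complex.Im (s y j))) ->
  (forall y, \sum_j cmod (s y j) ^+ 2 = tsq y) ->
  (forall y j, s (normalize y) j = (inv_norm (tsq y))%:C%C * s y j) ->
  (forall v x y, \sum_c tnth x c * tnth (scaled_parts s v y) c =
    \sum_j psi v x j * tnth y j) ->
  (forall v x, \sum_j psi v x j ^+ 2 <= cmod v ^+ 2 * tsq x) ->
  (forall i, 0 < sigma i) ->
  (forall t (j : 'I_N) c, j \notin S -> X t j c = 0) ->
  (forall t i c, X t (enum_val i) c = (sigma i)%:C%C * s (Y i t) c) ->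
  prob_at_least P [set t | unique_l21_min A (X t)]
    (1 - N%:R * expR (- (M%:R / 2) * (alpha ^- 2 - ln (alpha ^- 2) - 1))).
Proof.
move=> rA a0 a1 Aalpha indY isoY mRe mIm sN snorm adj psiN sig0 XS XE.
pose v l i := (pinvS A S *m col l A) i 0.
pose W l t c := \sum_(i < #|S|) tnth (scaled_parts s (cconj (v l i)) (normalize (Y i t))) c.
(* Indices in [S] get the empty event, so the union bound can run over all [N] indices. *)
pose bad (l : 'I_N) : set T := if l \in S then set0 else
  [set t | 1 <= \sum_(c < L + L) W l t c ^+ 2].
have mphi w : measurable_fun setT (scaled_parts s w).
  apply/measurable_fun_tnthP => c.
  apply: (eq_measurable_fun (fun y => match fintype.split c with
     | inl j => complex.Re w * complex.Re (s y j) - complex.Im w * complex.Im (s y j)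
     | inr j => complex.Re w * complex.Im (s y j) + complex.Im w * complex.Re (s y j)
     end)).
    by move=> y _ /=; rewrite tnth_mktuple; case: (fintype.split c) => j; rewrite ?ReM ?ImM.
  case: (fintype.split c) => j.
    by apply: measurable_funB; apply: measurable_funM.
  by apply: measurable_funD; apply: measurable_funM.
have cmodM (z1 z2 : C) : cmod (z1 * z2) ^+ 2 = cmod z1 ^+ 2 * cmod z2 ^+ 2.
  by rewrite !cmod_sq ReM ImM; ring.
have cmodJ (z : C) : cmod (cconj z) ^+ 2 = cmod z ^+ 2.
  by rewrite !cmod_sq /= sqrrN.
have phiN w y : tsq (scaled_parts s w y) = cmod w ^+ 2 * tsq y.
  rewrite -sN mulr_sumr /tsq big_split_ord/= -big_split/=; apply: eq_bigr => j _.
  by rewrite tnth_scaled_parts_l tnth_scaled_parts_r -cmodM cmod_sq.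
apply: (union_bound P N bad).
- move=> l; rewrite /bad; case: ifP => // _.
  have mW : measurable_fun setT (fun t => \sum_(c < L + L) W l t c ^+ 2).
    apply: measurable_sum => c; apply: measurable_funX; apply: measurable_sum => i.
    apply: (measurableT_comp (measurable_tnth_real _ c)).
    apply: (measurableT_comp (mphi _)).
    apply: (measurableT_comp (measurable_normalize M)); by case: indY.
  have -> : [set t | 1 <= \sum_(c < L + L) W l t c ^+ 2] =
      (fun t => \sum_(c < L + L) W l t c ^+ 2) @^-1` `[1, +oo[.
    by apply/seteqP; split=> t /=; rewrite in_itv/= andbT.
  exact: preimage_measurable.
- move=> l; rewrite /bad; case: ifPn => lS; first by rewrite measure0 lee_fin expR_ge0.
  apply: (isotropic_sum_tail P #|S| M (L + L) Y
    (fun i => scaled_parts s (cconj (v l i))) (fun i => psi (cconj (v l i)))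
    (fun i => cmod (v l i) ^+ 2)) => //.
  + by move=> i; exact: sqr_ge0.
  + by move=> i y; rewrite phiN cmodJ.
  + by move=> i x; rewrite -cmodJ.
  + have := Aalpha l lS; rewrite /vnorm2 -(ler_pXn2r (n := 2))// ?nnegrE ?sqrtr_ge0//.
      by rewrite sqr_sqrtr// sumr_ge0// => i _; exact: sqr_ge0.
    exact: ltW.
- move=> t good /=.
  pose sg i c := s (normalize (Y i t)) c.
  apply: (recovery_condition n N L A S (X t) sg rA) => //.
  + exact: XS.
  + move=> i; rewrite /rownorm sN -sqrtr1 ler_wsqrtr//; exact: tsq_normalize.
  (* sigma_i factors out of both sides. What remains, q / sqrt q = sqrt q, also holds at q = 0,
     where the inverse is 0. *)
  + move=> i; set y := Y i t.
    have q0 : 0 <= tsq y by exact: tsq_ge0.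
    have -> : rownorm L (X t (enum_val i)) = sigma i * Num.sqrt (tsq y).
      rewrite -(ger0_norm (ltW (sig0 i))) -sqrtr_sqr -sqrtrM ?sqr_ge0// -sN mulr_sumr.
      congr Num.sqrt; apply: eq_bigr => c _; rewrite XE cmodM; congr (_ * _).
      by rewrite cmod_sq /= expr0n addr0.
    have -> : redot L (sg i) (X t (enum_val i)) = inv_norm (tsq y) * sigma i * tsq y.
      rewrite /redot -[X in _ * X]sN mulr_sumr; apply: eq_bigr => c _.
      rewrite /sg snorm XE -/y cmod_sq.
      by case: (s y c) => [a b] /=; ring.
    rewrite mulrAC mulrC; congr (_ * _).
    rewrite inv_normE//; have [->|q1] := eqVneq (tsq y) 0; first by rewrite sqrtr0 mulr0.
    rewrite -[X in _ * X](sqr_sqrtr q0) expr2 mulKf// gt_eqF// sqrtr_gt0.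
    by rewrite lt0r q1.
  + move=> l lS; have := good l; rewrite /bad (negbTE lS) /= => /negP.
    rewrite -ltNge => W1; rewrite /rownorm -[ltRHS]sqrtr1 ltr_sqrt//.
    rewrite (le_lt_trans _ W1)// le_eqVlt; apply/orP; left; apply/eqP.
    rewrite [RHS]big_split_ord/= -big_split/=; apply: eq_bigr => c _.
    rewrite cmod_sq Re_sum Im_sum /W; congr (_ ^+ 2 + _ ^+ 2).
      by apply: eq_bigr => i _; rewrite tnth_scaled_parts_l.
    by apply: eq_bigr => i _; rewrite tnth_scaled_parts_r.
Qed.

End RandomRecovery.

Lemma iid_normal_family {R : realType} {d : measure_display} {T : measurableType d}
    (P : probability T R) (J : finType) (g : J -> T -> R) :
  mutually_independent P g -> (forall j, std_normal P (g j)) -> normal_family P J g.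
Proof.
move=> [mg Pg] ng; split=> // B mB; rewrite Pg//.
by apply: eq_bigr => j _; exact: ng.
Qed.

Lemma real_models_isotropic {R : realType} {d : measure_display} {T : measurableType d}
    (P : probability T R) k L (Phi : T -> 'M[R]_(k, L)) :
  real_gaussian P Phi \/ real_spherical P Phi ->
  mutually_independent P (fun i t => rrow (Phi t) i) /\
  forall i, isotropic P L (normalize \o (fun t => rrow (Phi t) i)).
Proof.
case=> -[ind law]; split.
- exact: (mutually_independent_tuple P _ L
    (fun (ij : 'I_k * 'I_L) t => Phi t ij.1 ij.2) ind).
- move=> i; apply: normal_family_isotropic; apply: iid_normal_family => //.
  have inji : injective (fun j : 'I_L => (i, j)) by move=> j j' [].
  exact: (mutually_independent_inj P _ _
    (fun (ij : 'I_k * 'I_L) t => Phi t ij.1 ij.2) _ inji ind).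
- exact: ind.
- move=> i; have := spherical_isotropic_real P L _ (law i).
  congr (isotropic P L (normalize \o _)); apply/funext => t.
  by apply: eq_from_tnth => j; rewrite !tnth_mktuple mxE.
Qed.

Lemma complex_models_isotropic {R : realType} {d : measure_display}
    {T : measurableType d} (P : probability T R) k L (Phi : T -> 'M[R[i]]_(k, L)) :
  complex_gaussian P Phi \/ complex_spherical P Phi ->
  mutually_independent P (fun i t => cflat (crow (Phi t) i)) /\
  forall i, isotropic P (L + L) (normalize \o (fun t => cflat (crow (Phi t) i))).
Proof.
case=> -[ind law]; last split.
(* Matches the coordinate order of [cflat]: real parts first, then imaginary parts. *)
- pose f (x : 'I_k * 'I_(L + L)) : 'I_k * 'I_L * bool :=
    match fintype.split x.2 with
    | inl j => (x.1, j, true) | inr j => (x.1, j, false) end.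
  pose part (x : 'I_k * 'I_L * bool) t :=
    if x.2 then complex.Re (Phi t x.1.1 x.1.2) else complex.Im (Phi t x.1.1 x.1.2).
  have injf : injective f.
    move=> [i c] [i' c']; rewrite /f /= -{2}(splitK c) -{2}(splitK c').
    by case: (fintype.split c) => j; case: (fintype.split c') => j' [] // -> ->.
  have indf := mutually_independent_inj P _ _ part f injf ind.
  have tupE : (fun i t => cflat (crow (Phi t) i)) =
      (fun i t => [tuple (part \o f) (i, c) t | c < L + L]).
    apply/funext => i; apply/funext => t; apply: eq_from_tnth => c.
    rewrite !tnth_mktuple /= /part /f /=.
    by case: (fintype.split c) => j; rewrite tnth_mktuple.
  rewrite tupE; split; first exact: (mutually_independent_tuple P _ _ (part \o f) indf).
  move=> i; have -> : (fun t => cflat (crow (Phi t) i)) =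
      (fun t => [tuple (part \o f) (i, c) t | c < L + L]).
    by have := congr1 (fun h => h i) tupE.
  apply: (normal_family_isotropic P (L + L) (fun c => (part \o f) (i, c))).
  apply: iid_normal_family => [|j]; last exact: law.
  have inji : injective (fun c : 'I_(L + L) => (i, c)) by move=> j j' [].
  exact: (mutually_independent_inj P _ _ (part \o f) _ inji indf).
- exact: (mutually_independent_comp P _ _ (fun=> @cflat R L)
    (fun=> measurable_cflat L) ind).
- move=> i; have := spherical_isotropic_complex P L _ (law i).
  congr (isotropic P (L + L) (normalize \o _)); apply/funext => t.
  congr cflat; apply: eq_from_tnth => j; rewrite !tnth_mktuple; by rewrite mxE.
Qed.

Theorem theorem3 (R : realType) (n N : nat) (A : 'M[R[i]]_(n, N))
  (S : {set 'I_N}) (alpha : R) :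
  \rank (colS A S) = #|S| ->
  0 < alpha -> alpha < 1 ->
  (forall l : 'I_N, l \notin S -> vnorm2 (pinvS A S *m col l A) <= alpha) ->
  (* real models *)
  (forall (d : measure_display) (T : measurableType d) (P : probability T R)
          (L : nat) (Sigma : 'M[R]_#|S|) (Phi : T -> 'M[R]_(#|S|, L))
          (X : T -> 'M[R[i]]_(N, L)),
     is_diag_mx Sigma -> (forall i, 0 < Sigma i i) ->
     real_gaussian P Phi \/ real_spherical P Phi ->
     (forall t (j : 'I_N) c, j \notin S -> X t j c = 0) ->
     (forall t (i : 'I_#|S|) c, X t (enum_val i) c = ((Sigma *m Phi t) i c)%:C%C) ->
     prob_at_least P [set t | unique_l21_min A (X t)]
       (1 - N%:R * expR (- (L%:R / 2) * (alpha ^- 2 - ln (alpha ^- 2) - 1)))) /\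
  (* complex models *)
  (forall (d : measure_display) (T : measurableType d) (P : probability T R)
          (L : nat) (Sigma : 'M[R]_#|S|) (Phi : T -> 'M[R[i]]_(#|S|, L))
          (X : T -> 'M[R[i]]_(N, L)),
     is_diag_mx Sigma -> (forall i, 0 < Sigma i i) ->
     complex_gaussian P Phi \/ complex_spherical P Phi ->
     (forall t (j : 'I_N) c, j \notin S -> X t j c = 0) ->
     (forall t (i : 'I_#|S|) c,
        X t (enum_val i) c = (map_mx (fun x : R => x%:C%C) Sigma *m Phi t) i c) ->
     prob_at_least P [set t | unique_l21_min A (X t)]
       (1 - N%:R * expR (- L%:R * (alpha ^- 2 - ln (alpha ^- 2) - 1)))).
Proof.
move=> rA a0 a1 Aalpha; split=> d T P L Sigma Phi X dSigma Sigma0 model XS XE.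
- have [indY isoY] := real_models_isotropic P _ L Phi model.
  (* The adjoint of y -> v y from R^L to C^L, namely x -> Re (conj v x). *)
  pose psi (v : R[i]) (x : (L + L).-tuple R) j :=
    complex.Re v * tnth x (lshift L j) + complex.Im v * tnth x (rshift L j).
  apply: (random_recovery L P n N L A S alpha _ (fun y j => (tnth y j)%:C%C) psi
    (fun i => Sigma i i) X rA a0 a1 Aalpha indY isoY) => //.
  + by move=> j; exact: measurable_tnth_real.
  + by move=> y; apply: eq_bigr => j _; rewrite cmod_sq /= expr0n addr0.
  + move=> y j; rewrite tnth_mktuple mulrC; exact: rmorphM.
  + move=> v x y; rewrite big_split_ord/= -big_split/=; apply: eq_bigr => j _.
    by rewrite tnth_scaled_parts_l tnth_scaled_parts_r ReM ImM /psi /=; ring.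
  + move=> v x; rewrite /tsq big_split_ord/= -big_split/= mulr_sumr.
    apply: ler_sum => j _; rewrite cmod_sq /psi -subr_ge0.
    set a := complex.Re v; set b := complex.Im v; set p := tnth _ _; set q := tnth _ _.
    (* The defect is the square of the imaginary part of conj v x. *)
    rewrite (_ : _ - _ = (a * q - b * p) ^+ 2) ?sqr_ge0//; ring.
  + move=> t i c; rewrite XE mxE (bigD1 i)//= big1 ?addr0; last first.
      move=> j ji; move/is_diag_mxP: dSigma => ->; rewrite ?mul0r//.
      by rewrite eq_sym.
    by rewrite tnth_mktuple; exact: rmorphM.
- have [indY isoY] := complex_models_isotropic P _ L Phi model.
  (* The complex rows live in dimension 2 L, which doubles the real rate. *)
  have -> : - L%:R = - ((L + L)%:R / 2) :> R by rewrite natrD; field.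
  pose s (y : (L + L).-tuple R) (j : 'I_L) : R[i] :=
    Complex (tnth y (lshift L j)) (tnth y (rshift L j)).
  (* Multiplication by conj v, the adjoint of multiplication by v; it scales lengths by exactly
     |v|. *)
  pose psi (v : R[i]) (x : (L + L).-tuple R) (c : 'I_(L + L)) :=
    match fintype.split c with
    | inl j => complex.Re v * tnth x (lshift L j) + complex.Im v * tnth x (rshift L j)
    | inr j => complex.Re v * tnth x (rshift L j) - complex.Im v * tnth x (lshift L j)
    end.
  have psil v x j : psi v x (lshift L j) =
      complex.Re v * tnth x (lshift L j) + complex.Im v * tnth x (rshift L j).
    by rewrite /psi (unsplitK (inl j)).
  have psir v x j : psi v x (rshift L j) =
      complex.Re v * tnth x (rshift L j) - complex.Im v * tnth x (lshift L j).
    by rewrite /psi (unsplitK (inr j)).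
  apply: (random_recovery L P n N (L + L) A S alpha _ s psi
    (fun i => Sigma i i) X rA a0 a1 Aalpha indY isoY) => //.
  + by move=> j; exact: measurable_tnth_real.
  + by move=> j; exact: measurable_tnth_real.
  + move=> y; rewrite /tsq big_split_ord/= -big_split/=; apply: eq_bigr => j _.
    by rewrite cmod_sq.
  + move=> y j; rewrite /s !tnth_mktuple; apply/eqP; rewrite eq_complex ReM ImM /=.
    by apply/andP; split; apply/eqP; ring.
  + move=> v x y; rewrite [LHS]big_split_ord [RHS]big_split_ord/= -!big_split/=.
    apply: eq_bigr => j _.
    by rewrite tnth_scaled_parts_l tnth_scaled_parts_r ReM ImM psil psir /=; ring.
  + move=> v x; rewrite /tsq [leLHS]big_split_ord [in leRHS]big_split_ord/= -!big_split/=.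
    rewrite mulr_sumr le_eqVlt; apply/orP; left; apply/eqP.
    by apply: eq_bigr => j _; rewrite cmod_sq psil psir; ring.
  + move=> t i c; rewrite XE mxE (bigD1 i)//= big1 ?addr0; last first.
      move=> j ji; rewrite mxE; move/is_diag_mxP: dSigma => ->; rewrite ?mul0r//.
      by rewrite eq_sym.
    rewrite mxE; congr (_ * _); rewrite /s !tnth_mktuple.
    rewrite (unsplitK (inl c)) (unsplitK (inr c)) !tnth_mktuple.
    by case: (Phi t i c).
Qed.
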